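(* Let $H\in\mathbb{C}^{N\times N}$ be Hermitian with eigenvalues $E_0\le E_1\le\dots\le E_{N-1}$, and let $z_k=a_k+ib_k$ with $a_k\in\mathbb{R}$ and $b_k>0$. For any tolerance $\epsilon>0$, the resolvent $R(z_k)=(z_k-H)^{-1}$ admits a real-time LCU construction $\mathcal{I}_J(z_k)$ with $\lVert R(z_k)-\mathcal{I}_J(z_k)\rVert_2<\epsilon$. Specifically, the Gauss--Legendre rule defines a time grid $\boldsymbol{t}=(t_0,\dots,t_{J-1})$ such that $$J=\log_2\log\frac{2}{\epsilon b_k}+(\eta_k+1)\log_2\frac{2}{\epsilon b_k}+3$$ distinct time-evolution circuits suffice to construct $\mathcal{I}_J(z_k)$, where $$\eta_k=\frac{3b_k-2\sqrt{2}\,b_k+a_k^{+}}{4\sqrt{2}\,b_k},\qquad a_k^{+}=\max_{0\le n\le N-1}|a_k-E_n|.$$ The corresponding maximal and total evolution times are $$T^{\max}=\lVert\boldsymbol{t}\rVert_\infty=\frac{1}{b_k}\log\frac{2}{\epsilon b_k},\qquad T^{\rm tot}=\lVert\boldsymbol{t}\rVert_1=\frac{J}{2b_k}\log\frac{2}{\epsilon b_k}.$$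
   Context: $\lVert\cdot\rVert_2$ is the operator (spectral) norm; $\log$ is the natural logarithm. For $b_k>0$ the resolvent has the integral representation $R(z_k)=-i\int_0^\infty e^{-b_kq}e^{i(a_k-H)q}\,dq$. A real-time LCU construction of an operator is an approximation of the form $\sum_{j=0}^{J-1}x_je^{-iHt_j}$ with scalar coefficients $x_j\in\mathbb{C}$ and evolution times $t_j\in\mathbb{R}$; the vector $\boldsymbol{t}=(t_0,\dots,t_{J-1})$ is the time grid, $\lVert\boldsymbol{t}\rVert_\infty=\max_j|t_j|$ and $\lVert\boldsymbol{t}\rVert_1=\sum_j|t_j|$. The Gauss--Legendre construction with truncation time $T>0$ and $J$ nodes is: let $s_0,\dots,s_{J-1}\in[-1,1]$ be the roots of the degree-$J$ Legendre polynomial with Gauss--Legendre weights $w_0,\dots,w_{J-1}$ (so that $\sum_j w_jp(s_j)=\int_{-1}^1p(s)ds$ for all polynomials $p$ of degree $\le 2J-1$), set $t_j=T(1+s_j)/2$ and $\mathcal{I}_J(z_k)=-i\frac{T}{2}\sum_{j=0}^{J-1}w_j e^{(ia_k-b_k)t_j}e^{-iHt_j}$, which discretizes the truncated integral $-i\int_0^{T}e^{-b_kq}e^{i(a_k-H)q}dq$.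
   Formalization: The maximal time is only bounded, ‖t‖_∞ ≤ (1/b_k)log(2/(εb_k)): equality fails as Gauss–Legendre nodes lie strictly inside (-1,1). Also εb_k<2 is assumed so T>0 and log₂log(2/(εb_k)) is defined; J is any integer at least the formula. *)

(* Defs.v *)
From HB Require Import structures.
From mathcomp Require Import all_boot all_order all_algebra.
From mathcomp Require Import all_classical all_reals all_analysis.
From mathcomp Require Import complex.
Set Implicit Arguments. Unset Strict Implicit. Unset Printing Implicit Defensive.
Import Order.TTheory GRing.Theory Num.Theory.
Import numFieldNormedType.Exports.
Local Open Scope ring_scope.

Section Defs.
Variable R : realType.
Local Notation C := R[i].

Definition reC (z : C) : R := complex.Re z.
Definition imC (z : C) : R := complex.Im z.
Definition toC (x : R) : C := Complex x 0.
Definition iC : C := Complex 0 1.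

Definition cexp (z : C) : C :=
  Complex (expR (reC z) * cos (imC z)) (expR (reC z) * sin (imC z)).

Definition is_hermitian_mx (N : nat) (H : 'M[C]_N) : Prop :=
  forall i j : 'I_N, H j i = conjc (H i j).

(* natural power of a square matrix (for any size N, including 0) *)
Definition mxpow (N : nat) (A : 'M[C]_N) (k : nat) : 'M[C]_N :=
  iter k (mulmx A) 1%:M.

Definition mxexp_partial (N : nat) (A : 'M[C]_N) (k : nat) : 'M[C]_N :=
  \sum_(m < k) (toC (m`!%:R)^-1 *: mxpow A m).

Definition mxexp (N : nat) (A : 'M[C]_N) : 'M[C]_N :=
  \matrix_(i, j) Complex (limn (fun k => reC (mxexp_partial A k i j)))
                         (limn (fun k => imC (mxexp_partial A k i j))).

Definition vnorm2 (N : nat) (v : 'cV[C]_N) : R :=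
  Num.sqrt (\sum_(i < N) (Normc.normc (v i 0)) ^+ 2).

Definition opnorm2 (N : nat) (A : 'M[C]_N) : R :=
  sup [set vnorm2 (A *m v) | v in [set v : 'cV[C]_N | vnorm2 v = 1]]%classic.

Definition resolvent (N : nat) (H : 'M[C]_N) (z : C) : 'M[C]_N :=
  invmx (z%:M - H).

(* degree-J Legendre polynomial (Rodrigues' formula) *)
Definition legendre (J : nat) : {poly R} :=
  ((2 ^ J * J`!)%:R)^-1 *: ((('X ^+ 2 - 1) ^+ J)^`(J)).

Definition gauss_legendre (J : nat) (s w : 'I_J -> R) : Prop :=
  injective s /\
  (forall j, -1 <= s j <= 1) /\
  (forall j, root (legendre J) (s j)) /\
  (forall p : {poly R}, (size p <= 2 * J)%N ->
     (\sum_(j < J) w j * p.[s j])%:E =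
      (\int[lebesgue_measure]_(x in `[(-1)%R, 1%R]%classic) (p.[x])%:E)%E).

Definition gl_times (J : nat) (T : R) (s : 'I_J -> R) (j : 'I_J) : R :=
  T * (1 + s j) / 2.

Definition gl_lcu (N J : nat) (H : 'M[C]_N) (z : C) (T : R)
    (s w : 'I_J -> R) : 'M[C]_N :=
  (- iC * toC (T / 2)) *:
   \sum_(j < J) ((toC (w j) * cexp ((iC * z) * toC (gl_times T s j)))
                  *: mxexp ((- iC * toC (gl_times T s j)) *: H)).

Definition tnorm_inf (J : nat) (t : 'I_J -> R) : R := \big[Num.max/0]_(j < J) `|t j|.
Definition tnorm_1 (J : nat) (t : 'I_J -> R) : R := \sum_(j < J) `|t j|.

Definition log2 (x : R) : R := ln x / ln 2.

End Defs.

(* Main.v *)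
(** The resolvent is the Laplace-type integral of [expR (- b q) * e^(i (a - H) q)];
    cutting it at [T = ln (2 / (eps b)) / b] costs [expR (- b T) / b = eps / 2].
    Diagonalizing [H] by a unitary reduces the quadrature error to that of
    Gauss-Legendre for [s |-> e^(mu s)] on [[-1, 1]], with
    [mu = i (z - E_n) T / 2]. If such an entire function is bounded by [M] on the
    Bernstein ellipse of parameter [rho], the image of [|u| = rho] under
    [u |-> (u + u^-1) / 2], its [k]-th Chebyshev coefficient is at most
    [2 M / rho ^ k]. The rule is exact in degree [< 2 J] and kills odd
    polynomials, so only the even coefficients of index at least [2 J] enter. With
    [rho = sqrt 2] the error is at most [(32 / 3) M / 2 ^ J], and
    [e^(- b T / 2) M <= e^(eta b T)]; the hypothesis on [J] then
    makes the contribution of the quadrature at most [eps / 3]. Working with the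
    Taylor polynomials of the exponential keeps all Chebyshev expansions finite, so
    that Cauchy's formula becomes an average over roots of unity. *)
Require Import Defs.
From HB Require Import structures.
From mathcomp Require Import all_boot all_order all_algebra.
From mathcomp Require Import all_classical all_reals all_analysis.
From mathcomp Require Import complex.
From mathcomp Require Import cyclic separable cyclotomic polyorder polyrcf spectral.
From mathcomp Require Import ring lra zify.
Set Implicit Arguments. Unset Strict Implicit. Unset Printing Implicit Defensive.
Import Order.TTheory GRing.Theory Num.Theory.
Import numFieldNormedType.Exports.
Local Open Scope ring_scope.

(** * Chebyshev polynomials and Bernstein ellipses *)

Lemma nat_ind2 (P : nat -> Prop) :
  P 0%N -> P 1%N -> (forall n, P n -> P n.+1 -> P n.+2) -> forall n, P n.
Proof.
move=> P0 P1 PS n; suff [] : P n /\ P n.+1 by [].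
by elim: n => // n [Pn PSn]; split=> //; apply: PS.
Qed.

Lemma ndvdn_between q m x : (q * m < x < q.+1 * m)%N -> (m %| x)%N = false.
Proof.
move=> /andP[h1 h2]; apply/negP => /dvdnP[c xE].
have m0 : (0 < m)%N by rewrite lt0n; apply: contraTneq h1 => m0; rewrite xE m0 !muln0.
by move: h1 h2; rewrite xE !ltn_pmul2r // ltnS => /leq_trans h /h; rewrite ltnn.
Qed.

Section Chebyshev.
Variable R : comNzRingType.

Fixpoint chebT (n : nat) : {poly R} :=
  if n is n1.+1 then
    if n1 is n2.+1 then 2 *: 'X * chebT n1 - chebT n2 else 'X
  else 1.

Fixpoint chebU (n : nat) : {poly R} :=
  if n is n1.+1 then
    if n1 is n2.+1 then 2 *: 'X * chebU n1 - chebU n2 else 2 *: 'X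
  else 1.

Lemma chebTSS n : chebT n.+2 = 2 *: 'X * chebT n.+1 - chebT n.
Proof. by []. Qed.

Lemma chebUSS n : chebU n.+2 = 2 *: 'X * chebU n.+1 - chebU n.
Proof. by []. Qed.

Lemma chebT_comp_opp n : chebT n \Po (- 'X) = (-1) ^+ n *: chebT n.
Proof.
elim/nat_ind2: n => [||n IH0 IH1].
- by rewrite scale1r rmorph1.
- by rewrite expr1 scaleN1r comp_polyX.
rewrite chebTSS; move: (chebT n.+1) (chebT n) IH1 IH0 => A B IH1 IH0.
rewrite rmorphB rmorphM /= linearZ /= comp_polyX IH0 IH1.
by rewrite !exprS -!mul_polyC !rmorphM /= polyCN; ring.
Qed.

(** Combined with [deriv_chebT], this turns the integral of [chebT] into boundary values. *)
Lemma chebT_chebU n : 2 *: chebT n.+2 = chebU n.+2 - chebU n.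
Proof.
elim/nat_ind2: n => [||n IH0 IH1].
- by rewrite /= -!mul_polyC; ring.
- by rewrite /= -!mul_polyC; ring.
rewrite chebTSS scalerBr IH0 scalerAr IH1 (chebUSS n.+2).
have := chebUSS n.
move: (chebU n.+3) (chebU n.+2) (chebU n.+1) (chebU n) => A B D E ->.
by rewrite -!mul_polyC; ring.
Qed.

Lemma deriv_chebT n : (chebT n.+1)^`() = n.+1%:R *: chebU n.
Proof.
elim/nat_ind2: n => [||n IH0 IH1].
- by rewrite /= derivX scale1r.
- by rewrite /= derivB derivM !derivZ derivX derivC -!mul_polyC; ring.
rewrite chebTSS derivB derivM derivZ derivX IH0 IH1.
have -> : (2 *: 1 * chebT n.+2 : {poly R}) = 2 *: chebT n.+2.
  by rewrite -!mul_polyC; ring.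
rewrite chebT_chebU chebUSS -!mul_polyC !polyC_natr -[n.+3]addn3 -[n.+2]addn2 -[n.+1]addn1
  !natrD; ring.
Qed.

Lemma chebT1 n : (chebT n).[1] = 1.
Proof.
elim/nat_ind2: n => [||n IH0 IH1]; rewrite ?hornerC ?hornerX //.
by rewrite chebTSS !hornerE IH0 IH1; ring.
Qed.

Lemma chebTN1 n : (chebT n).[-1] = (-1) ^+ n.
Proof.
have := congr1 (fun p => p.[1]) (chebT_comp_opp n).
by rewrite /= horner_comp !hornerE chebT1 mulr1.
Qed.
End Chebyshev.
Arguments chebT : simpl never.
Arguments chebU : simpl never.

Lemma map_chebT (R S : comNzRingType) (f : {rmorphism R -> S}) n :
  map_poly f (chebT R n) = chebT S n.
Proof.
elim/nat_ind2: n => [||n IH0 IH1]; rewrite ?rmorph1 ?map_polyX //.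
by rewrite !chebTSS rmorphB rmorphM /= map_polyZ map_polyX IH0 IH1 rmorph_nat.
Qed.

Section ChebyshevField.
Variable F : numFieldType.

Lemma size_chebT n : size (chebT F n) = n.+1.
Proof.
suff H m : size (chebT F m) = m.+1 /\ size (chebT F m.+1) = m.+2 by case: (H n).
elim: m => [|m [IH0 IH1]]; first by rewrite size_poly1 size_polyX.
split=> //; rewrite chebTSS -scalerAl size_polyDl.
  by rewrite size_scale ?pnatr_eq0 // mulrC size_mulX ?IH1 // -size_poly_eq0 IH1.
by rewrite size_polyN size_scale ?pnatr_eq0 // mulrC size_mulX ?IH1 ?IH0 // -size_poly_eq0 IH1.
Qed.

(** [chebT n] has degree exactly [n], so subtracting a multiple of it removes the top
    coefficient. *)
Lemma cheb_expansion n (p : {poly F}) : (size p <= n)%N ->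
  exists a : nat -> F, p = \sum_(k < n) a k *: chebT F k.
Proof.
elim: n p => [|n IH] p szp.
  by exists (fun=> 0); rewrite big_ord0; apply/eqP; rewrite -size_poly_eq0 -leqn0.
have lT : (chebT F n)`_n != 0.
  by have := lead_coef_eq0 (chebT F n); rewrite lead_coefE size_chebT /=
    -size_poly_eq0 size_chebT => ->.
pose c := p`_n / (chebT F n)`_n.
have [|a Ha] := IH (p - c *: chebT F n).
  apply/leq_sizeP => j; rewrite leq_eqVlt => /orP[/eqP <-|nj].
    by rewrite coefB coefZ /c divfK // subrr.
  rewrite coefB coefZ !nth_default ?mulr0 ?subr0 // ?size_chebT //.
  exact: leq_trans szp nj.
exists (fun k => if k == n then c else a k).
rewrite big_ord_recr /= eqxx -[LHS](subrK (c *: chebT F n)) Ha; congr (_ + _).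
by apply: eq_bigr => i _; rewrite ltn_eqF.
Qed.

(** Both sides obey the same three-term recurrence; for [u = e^(i t)] this is the cosine identity
    for [cos (n t)]. *)
Lemma chebT_joukowski n (u : F) : u != 0 ->
  (chebT F n).[(u + u^-1) / 2] = (u ^+ n + u ^- n) / 2.
Proof.
move=> u0; elim/nat_ind2: n => [||n IH0 IH1].
- by rewrite hornerC !expr0 invr1; field.
- by rewrite hornerX.
rewrite chebTSS hornerD hornerN hornerM hornerZ hornerX IH0 IH1 !exprS.
move: (expf_neq0 n u0).
by move: (u ^+ n) => v v0; field; rewrite ?u0 ?v0.
Qed.
End ChebyshevField.

Section ChebyshevClosed.
Variable C : numClosedFieldType.

(** [X^n - 1] splits and is separable, hence has [n] distinct roots, enough for [has_prim_root]. *)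
Lemma closed_prim_root_exists n : (n > 0)%N -> exists z : C, n.-primitive_root z.
Proof.
pose p : {poly C} := 'X^n - 1; have [r Dp] := closed_field_poly_normal p.
move=> n_gt0; rewrite (monicP _) ?monicXnsubC // scale1r in Dp.
have rn1: all n.-unity_root r by apply/allP=> z; rewrite -root_prod_XsubC -Dp.
have sz_r: (n < (size r).+1)%N.
  by rewrite -(size_prod_XsubC r id) -Dp size_XnsubC.
have [|z] := hasP (has_prim_root n_gt0 rn1 _ sz_r); last by exists z.
by rewrite -separable_prod_XsubC -Dp separable_Xn_sub_1 // pnatr_eq0 -lt0n.
Qed.

Lemma prim_root_sum m (w : C) e : m.-primitive_root w ->
  \sum_(l < m) w ^+ (l * e) = if (m %| e)%N then m%:R else 0.
Proof.
move=> pw; under eq_bigr do rewrite mulnC exprM.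
rewrite (prim_order_dvd pw); case: eqP => [->|/eqP we].
  by under eq_bigr do rewrite expr1n; rewrite sumr_const card_ord.
apply: (mulfI (_ : w ^+ e - 1 != 0)); first by rewrite subr_eq0.
by rewrite mulr0 -subrX1 -exprM mulnC exprM (prim_expr_order pw) expr1n subrr.
Qed.

Lemma prim_root_norm m (w : C) : m.-primitive_root w -> `|w| = 1.
Proof.
move=> pw; apply/eqP; rewrite -(@pexpr_eq1 _ _ m) ?(prim_order_gt0 pw) //.
by rewrite -normrX (prim_expr_order pw) normr1.
Qed.

Lemma chebT_norm_le1 n (x : C) : -1 <= x <= 1 -> `|(chebT C n).[x]| <= 1.
Proof.
move=> /andP[x1 x2].
have xR : x \is Num.real by rewrite (ger_real x1) ?realN ?real1 // realE; apply/orP; left.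
pose y := sqrtC (1 - x ^+ 2).
have y0 : 0 <= 1 - x ^+ 2.
  by rewrite subr_ge0 -real_normK // expr_le1 // real_ler_norml // x1.
have yR : y \is Num.real by rewrite ger0_real // sqrtC_ge0.
have yE : y ^+ 2 = 1 - x ^+ 2 by rewrite sqrtCK.
have i2 : 'i ^+ 2 = -1 :> C by rewrite sqrCi.
(* With [x = cos t] this is [e^(i t)]: a point of the unit circle whose Joukowski image is [x]. *)
pose u := x + 'i * y.
have uv : u * (x - 'i * y) = 1.
  have -> : u * (x - 'i * y) = x ^+ 2 - 'i ^+ 2 * y ^+ 2 by rewrite /u; ring.
  by rewrite i2 yE; ring.
have u0 : u != 0 by apply: contra_eq_neq uv => ->; rewrite mul0r eq_sym oner_eq0.
have uV : u^-1 = x - 'i * y by apply: (mulfI u0); rewrite mulfV.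
have -> : x = (u + u^-1) / 2 by rewrite uV /u; field.
have nu : `|u| = 1.
  apply/eqP; rewrite -(@pexpr_eq1 _ _ 2) // normC2_rect //.
  by rewrite yE; apply/eqP; ring.
rewrite chebT_joukowski // normrM normfV normr_nat ler_pdivrMr ?ltr0n // mul1r.
by rewrite (le_trans (ler_normD _ _)) // normfV normrX nu expr1n invr1.
Qed.

(* Averaging against the 2n-th roots of unity isolates one Laurent coefficient of
   the expansion pulled back by the Joukowski map. *)
Lemma cheb_coef_bound n (a : nat -> C) (rho B : C) k : 0 < rho ->
  (forall u : C, `|u| = rho ->
     `|(\sum_(j < n) a j *: chebT C j).[(u + u^-1) / 2]| <= B) ->
  (0 < k < n)%N -> `|a k| <= 2 * B / rho ^+ k.
Proof.
move=> rho0 HB /andP[k0 kn].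
have rhoN0 : rho != 0 by rewrite gt_eqF.
(* With [m = 2 n] the sums [j + k] stay strictly between 0 and [m], so no frequency [- j] is aliased
   onto [k]. *)
pose m := n.*2; have m0 : (0 < m)%N by rewrite /m; lia.
have [w pw] := closed_prim_root_exists m0.
have nw := prim_root_norm pw.
have w0 : w != 0 by rewrite -normr_gt0 nw ltr01.
have wm e : (e <= m)%N -> w ^- e = w ^+ (m - e).
  move=> em; apply: (mulfI (expf_neq0 e w0)).
  by rewrite mulfV ?expf_neq0 // -exprD subnKC // (prim_expr_order pw).
pose p := \sum_(j < n) a j *: chebT C j.
pose u (l : nat) := rho * w ^+ l.
(* The factor [w ^+ (l * (m - k))] equals [w ^- (l * k)]; negative exponents are written as
   complements to [m] so as to remain natural numbers. *)
have key : \sum_(l < m) p.[(u l + (u l)^-1) / 2] * w ^+ (l * (m - k)) = m%:R * (a k * rho ^+ k / 2).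
  transitivity (\sum_(j < n) a j / 2 * (rho ^+ j * (\sum_(l < m) w ^+ (l * (j + (m - k))))
      + rho ^- j * (\sum_(l < m) w ^+ (l * ((m - j) + (m - k)))))).
    transitivity (\sum_(l < m) \sum_(j < n) a j / 2 * (rho ^+ j * w ^+ (l * (j + (m - k)))
      + rho ^- j * w ^+ (l * ((m - j) + (m - k))))).
      apply: eq_bigr => l _; rewrite /p horner_sum mulr_suml; apply: eq_bigr => j _.
      rewrite hornerZ chebT_joukowski ?mulf_neq0 ?expf_neq0 //.
      rewrite /u !exprMn -!exprM invfM.
      have -> : w ^- (l * j) = w ^+ (l * (m - j)).
        apply: (mulfI (expf_neq0 (l * j) w0)).
        rewrite mulfV ?expf_neq0 // -exprD -mulnDr subnKC; last first.
          by have := ltn_ord j; rewrite /m; lia.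
        by rewrite mulnC exprM (prim_expr_order pw) expr1n.
      by rewrite !mulnDr !exprD; field; rewrite expf_neq0.
    rewrite exchange_big; apply: eq_bigr => j _.
    rewrite -mulr_sumr big_split /= -!mulr_sumr //.
  rewrite (bigD1 (Ordinal kn)) //= [X in _ + X]big1 ?addr0.
    rewrite !(prim_root_sum _ pw).
    have -> : (m %| k + (m - k))%N by rewrite subnKC // /m; lia.
    have -> : (m %| m - k + (m - k))%N = false.
      by apply: (@ndvdn_between 1); rewrite /m; lia.
    by field; rewrite expf_neq0.
  move=> j jk; rewrite !(prim_root_sum _ pw).
  have jn := ltn_ord j.
  have jk' : (j : nat) <> k by move=> e; case/eqP: jk; apply: val_inj.
  have -> : (m %| j + (m - k))%N = false.
    have [jk1|jk1] := ltnP j k.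
      by apply: (@ndvdn_between 0); rewrite /m; lia.
    by apply: (@ndvdn_between 1); rewrite /m; lia.
  have -> : (m %| m - j + (m - k))%N = false.
    by apply: (@ndvdn_between 1); rewrite /m; lia.
  by rewrite !mulr0 addr0 mulr0.
have : `|m%:R * (a k * rho ^+ k / 2)| <= m%:R * B.
  rewrite -key (le_trans (ler_norm_sum _ _ _)) //.
  have -> : m%:R * B = \sum_(l < m) B by rewrite sumr_const card_ord mulr_natl.
  apply: ler_sum => l _; rewrite normrM normrX nw expr1n mulr1 HB //.
  by rewrite normrM normrX nw expr1n mulr1 gtr0_norm.
rewrite normrM normr_nat ler_pM2l ?ltr0n // !normrM normfV normr_nat.
rewrite (gtr0_norm (exprn_gt0 _ rho0)) ler_pdivrMr ?ltr0n // => h.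
by rewrite ler_pdivlMr ?exprn_gt0 // mulrC [2 * B]mulrC // mulrC.
Qed.

(* [2 ^+ J] is [rho ^+ (2 * J)] for the Bernstein ellipse parameter [rho = sqrt 2],
   the choice behind the constant [eta]. *)
Lemma functional_bound (l : {linear {poly C} -> C^o}) (J : nat) (D B : C)
    (p : {poly C}) :
  (0 < J)%N ->
  (forall k, (k < J.*2)%N -> l (chebT C k) = 0) ->
  (forall k, odd k -> l (chebT C k) = 0) ->
  (forall k, (J.*2 <= k)%N -> `|l (chebT C k)| <= D) ->
  (forall u : C, `|u| = sqrtC 2 -> `|p.[(u + u^-1) / 2]| <= B) ->
  `|l p| <= 4 * D * B / 2 ^+ J.
Proof.
move=> J0 lJ lodd lD pB.
pose n := (J + size p)%N.
have [|a pE] := @cheb_expansion C n.*2 p.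
  by rewrite -addnn (leq_trans (leq_addl J _)) // leq_addr.
have s2 : 0 < sqrtC (2 : C) by rewrite sqrtC_gt0 ltr0n.
have B0 : 0 <= B.
  by apply: le_trans (pB (sqrtC 2) (gtr0_norm s2)); rewrite normr_ge0.
have D0 : 0 <= D by apply: le_trans (lD _ (leqnn _)); rewrite normr_ge0.
have abound k : (0 < k < n)%N -> `|a k.*2| <= 2 * B / 2 ^+ k.
  move=> kn; have := @cheb_coef_bound n.*2 a (sqrtC 2) B k.*2 s2.
  rewrite -pE -[in sqrtC 2 ^+ k.*2]mul2n exprM sqrtCK; apply=> //; lia.
(* Two indices are added at a time: the odd one contributes nothing, the even one [2 k] at most
   [2 D B / 2 ^ k]. The bracket is the sum of [2 ^- k] over [J <= k < J + q]. *)
have S q : (q <= size p)%N -> \sum_(k < (J + q).*2) `|a k * l (chebT C k)|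
    <= 2 * D * B * (2 / 2 ^+ J - 2 / 2 ^+ (J + q)).
  elim: q => [|q IH] qp.
    rewrite addn0 subrr mulr0 big1 // => k _.
    by rewrite lJ ?ltn_ord // mulr0 normr0.
  rewrite addnS doubleS !big_ord_recr /=.
  rewrite [l (chebT C (J + q).*2.+1)]lodd /= ?odd_double // mulr0 normr0 addr0.
  have -> : 2 * D * B * (2 / 2 ^+ J - 2 / 2 ^+ (J + q).+1) =
    2 * D * B * (2 / 2 ^+ J - 2 / 2 ^+ (J + q)) + (2 * B / 2 ^+ (J + q)) * D.
    by rewrite exprS; field; rewrite !expf_neq0 // pnatr_eq0.
  rewrite lerD ?IH //; first lia.
  rewrite normrM ler_pM ?normr_ge0 ?abound ?lD //; lia.
rewrite pE linear_sum (le_trans (ler_norm_sum _ _ _)) //.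
under eq_bigr do rewrite linearZ /=.
rewrite (le_trans (S _ (leqnn _))) //.
have -> : 4 * D * B / 2 ^+ J = 2 * D * B * (2 / 2 ^+ J) by ring.
rewrite ler_wpM2l ?mulr_ge0 ?ler0n // gerBl.
by rewrite mulr_ge0 ?invr_ge0 ?exprn_ge0 ?ler0n.
Qed.
End ChebyshevClosed.

(** * Gauss-Legendre quadrature *)

Lemma oppr_fix_eq0 (F : numDomainType) (x : F) : - x = x -> x = 0.
Proof. by move/eqP; rewrite eq_sym -addr_eq0 -mulr2n mulrn_eq0 => /eqP. Qed.

Section PolyIntegral.
Variable F : numFieldType.
Implicit Types p q : {poly F}.

(** The integral of [x ^ i] over [[-1, 1]]. *)
Definition moment (i : nat) : F := (1 - (-1) ^+ i.+1) / i.+1%:R.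

(* The integral of [p] over [[-1, 1]]. *)
Definition pint p : F := \sum_(i < size p) p`_i * moment i.

Lemma pint_wide n p : (size p <= n)%N -> pint p = \sum_(i < n) p`_i * moment i.
Proof.
move=> szp; rewrite /pint (big_ord_widen n (fun i => p`_i * moment i)) //.
rewrite big_mkcond; apply: eq_bigr => i _.
by case: ltnP => // h; rewrite nth_default ?mul0r.
Qed.

Lemma pint_is_scalar : scalar pint.
Proof.
move=> k p q; pose n := maxn (size p) (size q).
have szp : (size p <= n)%N by rewrite leq_maxl.
have szq : (size q <= n)%N by rewrite leq_maxr.
have szpq : (size (k *: p + q)%R <= n)%N.
  rewrite (leq_trans (size_polyD _ _)) // geq_max szq andbT.
  exact: leq_trans (size_scale_leq _ _) szp.
rewrite !(@pint_wide n) // mulr_sumr -big_split /=; apply: eq_bigr => i _.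
by rewrite coefD coefZ mulrDl mulrA.
Qed.

HB.instance Definition _ :=
  GRing.isLinear.Build F {poly F} F _ pint pint_is_scalar.

Lemma pint_deriv p : pint p^`() = p.[1] - p.[-1].
Proof.
rewrite (@pint_wide (size p)); last first.
  by rewrite (leq_trans (size_poly _ _)) // leq_pred.
rewrite !(@horner_coef_wide _ (size p).+1) // -sumrB big_ord_recl /=.
rewrite !expr0 subrr add0r; apply: eq_bigr => i _.
rewrite coef_deriv /moment /bump /= add1n expr1n mulrnAl -mulrnAr -mulrBr.
by congr (_ * _); rewrite -mulr_natr divfK // pnatr_eq0.
Qed.

Lemma antiderivative p : exists q, p = q^`().
Proof.
exists (\poly_(i < (size p).+1) (p`_i.-1 / i%:R)); apply/polyP => i.
rewrite coef_deriv coef_poly ltnS; case: ltnP => h /=.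
  by rewrite -[RHS]mulr_natr divfK // pnatr_eq0.
by rewrite nth_default // mul0rn.
Qed.

Lemma pint_comp_opp p : pint (p \Po - 'X) = pint p.
Proof.
have [q ->] := antiderivative p.
have -> : q^`() \Po - 'X = - (q \Po - 'X)^`().
  by rewrite deriv_comp derivN derivX mulrN1 opprK.
by rewrite linearN /= !pint_deriv !horner_comp !hornerE opprK opprB.
Qed.

Lemma pint_odd p : p \Po - 'X = - p -> pint p = 0.
Proof.
move=> h; apply: oppr_fix_eq0.
by rewrite -{2}pint_comp_opp h linearN.
Qed.

Lemma pint_chebU k : ~~ odd k -> pint (chebU F k) = 2 / k.+1%:R.
Proof.
move=> ek; have := pint_deriv (chebT F k.+1).
rewrite deriv_chebT linearZ chebT1 chebTN1 exprS -signr_odd (negbTE ek) /= => h.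
have -> : pint (chebU F k) = (1 - (-1) * (-1) ^+ false) / k.+1%:R.
  by rewrite -h mulrAC mulfV ?mul1r ?pnatr_eq0.
by rewrite expr0 mulr1 opprK.
Qed.

Lemma pint_chebT_even k : ~~ odd k ->
  pint (chebT F k.+2) = k.+3%:R^-1 - k.+1%:R^-1.
Proof.
move=> ek; apply: (mulfI (_ : 2 != 0 :> F)); first by rewrite pnatr_eq0.
have := congr1 pint (chebT_chebU F k).
rewrite linearZ [pint (chebU F k.+2 - _)]linearB /= => ->; rewrite !pint_chebU //=; last by rewrite negbK.
by rewrite mulrBr.
Qed.

(** The absolute value is [2 / ((k + 1) (k + 3))], which is largest at [k = 0]. *)
Lemma pint_chebT_norm k : ~~ odd k -> `|pint (chebT F k.+2)| <= 2 / 3.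
Proof.
move=> ek; rewrite pint_chebT_even // distrC.
have k1 : 0 < k.+1%:R :> F by rewrite ltr0n.
have k3 : 0 < k.+3%:R :> F by rewrite ltr0n.
have h : k.+1%:R^-1 - k.+3%:R^-1 = 2 / (k.+1%:R * k.+3%:R) :> F.
  rewrite (_ : k.+3%:R = k.+1%:R + 2 :> F); last by rewrite -natrD; congr _%:R; lia.
  have k2 : k.+1%:R + 2 > 0 :> F by rewrite addr_gt0 // ltr0n.
  by move: k1 k2; move: k.+1%:R => x x0 x2; field; rewrite !gt_eqF.
rewrite h ger0_norm; last by rewrite divr_ge0 ?mulr_ge0 ?ler0n.
rewrite ler_wpM2l ?ler0n // lef_pV2 ?posrE ?mulr_gt0 // -natrM ler_nat; lia.
Qed.

End PolyIntegral.

Lemma pint_map (F G : numFieldType) (f : {rmorphism F -> G}) (p : {poly F}) :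
  pint (map_poly f p) = f (pint p).
Proof.
rewrite /pint size_map_poly rmorph_sum; apply: eq_bigr => i _.
rewrite coef_map rmorphM; congr (_ * _).
by rewrite /moment fmorph_div rmorphB rmorphXn rmorphN !rmorph1 rmorph_nat.
Qed.

(** * Roots, orthogonality and parity of the Legendre polynomial *)

Section RolleIteration.
Variable R : rcfType.
Implicit Types p q : {poly R}.

(** Rolle's theorem is applied in every gap; keeping the new roots sorted and below the last old one
    allows the step to be iterated. *)
Lemma rolle_path p (x : R) s : path <%R x s -> all (root p) (x :: s) ->
  exists t, [/\ size t = size s, path <%R x t, all (< last x s) t
    & all (root p^`()) t].
Proof.
elim: s x => [|y s IH] x /=; first by move=> _ _; exists [::].
move=> /andP[xy ys] /and3P[rx ry rs].
have [|t [st pt lt rt]] := IH y ys; first by rewrite /= ry.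
have [|c] := @poly_rolle _ x y p xy; first by rewrite (rootP rx) (rootP ry).
rewrite in_itv /= => /andP[xc cy] dc.
exists (c :: t); split => /=.
- by rewrite st.
- rewrite xc /=; case: t pt {st lt rt} => //= z t /andP[yz ->].
  by rewrite (lt_trans cy yz).
- rewrite lt andbT (lt_le_trans cy) //.
  have := order_path_min lt_trans ys => /allP h.
  by have := mem_last y s; rewrite inE => /orP[/eqP ->|/h /ltW].
- by rewrite rt andbT; apply/rootP.
Qed.

Lemma dvdp_deriv_exp p q k : q ^+ k.+1 %| p -> q ^+ k %| p^`().
Proof.
move=> /dvdpP[r ->]; rewrite derivM deriv_exp /= exprS.
apply: dvdp_add; first by rewrite mulrA dvdp_mull.
by rewrite dvdp_mull // -mulrnAl dvdp_mull.
Qed.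

Lemma dvdp_derivn_exp p q k m : q ^+ (k + m) %| p -> q ^+ k %| p^`(m).
Proof.
elim: m k => [|m IH] k; first by rewrite addn0.
by rewrite -addSnnS => /IH h; rewrite derivnS dvdp_deriv_exp.
Qed.

Lemma root_derivn_exp p (c : R) k m :
  ('X - c%:P) ^+ k %| p -> (m < k)%N -> root p^`(m) c.
Proof.
move=> h mk; rewrite -dvdp_XsubCl -[X in X %| _]expr1.
apply: dvdp_derivn_exp; apply: dvdp_trans h; exact: dvdp_exp2l.
Qed.

Variable J : nat.
Let W : {poly R} := ('X ^+ 2 - 1) ^+ J.

(** Both endpoints are roots of [W] of multiplicity [J], and each derivation lowers the multiplicity
    by one. *)
Lemma root_rodrigues m : (m < J)%N -> root W^`(m) 1 /\ root W^`(m) (-1).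
Proof.
have e : W = ('X - 1%:P) ^+ J * ('X - (-1)%:P) ^+ J.
  by rewrite -exprMn /W; congr (_ ^+ _); rewrite polyCN; ring.
by move=> mJ; split; apply: (@root_derivn_exp _ _ J) => //; rewrite e;
  [apply: dvdp_mulr|apply: dvdp_mull].
Qed.

Lemma rodrigues_roots : exists t : seq R, [/\ size t = J, uniq t,
  all (fun x => -1 < x < 1) t & all (root W^`(J)) t].
Proof.
(* The [i] interior roots of the [i]-th derivative, together with the endpoints, leave [i + 1] gaps
   for Rolle's theorem. *)
suff H i : (i <= J)%N -> exists t : seq R, [/\ size t = i, path <%R (-1) t,
    all (< 1) t & all (root W^`(i)) t].
  have [t [st pt lt rt]] := H J (leqnn J); exists t; split=> //.
    by apply: lt_sorted_uniq; apply: path_sorted pt.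
  have /allP h := order_path_min lt_trans pt.
  by apply/allP => x xt; rewrite h //=; apply: (allP lt).
elim: i => [|i IH] iJ; first by exists [::].
have [t [st pt lt rt]] := IH (ltnW iJ).
have [r1 rN1] := root_rodrigues iJ.
have [||u [su pu lu ru]] := @rolle_path W^`(i) (-1) (rcons t 1).
- rewrite rcons_path pt /=.
  have := mem_last (-1) t; rewrite inE => /orP[/eqP ->|/(allP lt)//].
  by rewrite gtrN.
- by rewrite /= all_rcons r1 rN1.
exists u; split; [by rewrite su size_rcons st|by []| |by rewrite derivnS].
by move: lu; rewrite last_rcons.
Qed.

Lemma size_rodrigues : size W^`(J) = J.+1.
Proof.
have h m : size W^`(m) = (J.*2.+1 - m)%N.
  elim: m => [|m IH]; last by rewrite derivnS size_deriv IH subnS.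
  by rewrite subn0 /W derivn0 my_size_exp ?size_XnsubC ?monic_neq0 ?monicXnsubC // -mul2n.
by rewrite h; lia.
Qed.

(** Repeated integration by parts: the boundary terms vanish by [root_rodrigues], and each step
    differentiates [q] once until it is zero. *)
Lemma pint_rodrigues_orth q : (size q <= J)%N -> pint (q * W^`(J)) = 0.
Proof.
suff H k : (k <= J)%N -> forall q, (size q <= k)%N -> pint (q * W^`(k)) = 0.
  exact: H.
elim: k => [|k IH] kJ {}q szq.
  by move: szq; rewrite leqn0 size_poly_eq0 => /eqP ->; rewrite mul0r linear0.
have -> : q * W^`(k.+1) = (q * W^`(k))^`() - q^`() * W^`(k).
  by rewrite derivM derivnS; ring.
rewrite linearB /= pint_deriv IH ?subr0; last first.
- by rewrite size_deriv -subn1 leq_subLR add1n.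
- exact: ltnW.
have [/rootP r1 /rootP rN1] := root_rodrigues kJ.
by rewrite !hornerM r1 rN1 !mulr0 subrr.
Qed.

(** [W] is even and each derivation flips the parity; this is the source of the symmetry of the
    nodes. *)
Lemma rodrigues_comp_opp : W^`(J) \Po - 'X = (-1) ^+ J *: W^`(J).
Proof.
have h m : W^`(m) \Po - 'X = (-1) ^+ m *: W^`(m).
  elim: m => [|m IH].
    rewrite scale1r /W rmorphXn rmorphB rmorphXn /= comp_polyX comp_polyC.
    by rewrite sqrrN.
  have := congr1 (@deriv R) IH.
  rewrite deriv_comp derivN derivX derivZ -derivnS mulrN1 => /(congr1 -%R).
  by rewrite opprK => ->; rewrite exprS mulN1r scaleNr.
exact: h.
Qed.

End RolleIteration.

(** * Lagrange interpolation and the Gauss rule *)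

Section GaussRule.
Variable R : rcfType.
Variables (J : nat) (s : 'I_J -> R).
Hypothesis s_inj : injective s.

Definition nodal : {poly R} := \prod_(j < J) ('X - (s j)%:P).

Definition lagr (j : 'I_J) : {poly R} :=
  \prod_(k < J | k != j) ((s j - s k)^-1 *: ('X - (s k)%:P)).

Lemma lagrE j i : (lagr j).[s i] = (i == j)%:R.
Proof.
rewrite /lagr horner_prod; case: eqVneq => [->|ij].
  rewrite big1 // => k kj; rewrite !hornerE mulVf // subr_eq0.
  by apply: contra kj => /eqP /s_inj ->.
by rewrite (bigD1 i) //= !hornerE subrr mulr0 mul0r.
Qed.

Lemma size_lagr j : (size (lagr j) <= J)%N.
Proof.
have jJ := ltn_ord j.
rewrite /lagr; apply: leq_trans (size_poly_prod_leq _ _) _.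
have h : (\sum_(i < J | i != j) size ((s j - s i)^-1 *: ('X - (s i)%:P)) <= 2 * J.-1)%N.
  apply: leq_trans (_ : \sum_(i < J | i != j) 2 <= _)%N.
    by apply: leq_sum => i _; rewrite (leq_trans (size_scale_leq _ _)) // size_XsubC.
  by rewrite sum_nat_const cardC1 card_ord mulnC.
have e : #|(fun i : 'I_J => i != j)| = J.-1.
  by rewrite -[X in _ = X.-1](card_ord J) -(cardC1 j); apply: eq_card.
apply: leq_trans (leq_sub (h : _ < (2 * J.-1).+1)%N (eq_leq (esym e))) _; lia.
Qed.

Lemma nodalE : nodal = \prod_(x <- [seq s j | j <- enum 'I_J]) ('X - x%:P).
Proof. by rewrite big_map big_enum. Qed.

Lemma size_nodal : size nodal = J.+1.
Proof.
by rewrite nodalE size_prod_XsubC size_map -cardE card_ord.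
Qed.

Lemma nodal_neq0 : nodal != 0.
Proof. by rewrite -size_poly_eq0 size_nodal. Qed.

Lemma horner_nodal j : nodal.[s j] = 0.
Proof. by rewrite /nodal horner_prod (bigD1 j) //= !hornerE subrr mul0r. Qed.

(** The difference of the two sides has [J] distinct roots and size at most [J]. *)
Lemma lagrange_interp (p : {poly R}) : (size p <= J)%N ->
  p = \sum_(j < J) p.[s j] *: lagr j.
Proof.
move=> szp; apply/eqP; rewrite -subr_eq0; apply/eqP.
apply: (@roots_geq_poly_eq0 _ _ [seq s j | j <- enum 'I_J]).
- apply/allP => _ /mapP[i _ ->]; apply/rootP.
  rewrite hornerD hornerN horner_sum (bigD1 i) //= hornerZ lagrE eqxx mulr1.
  rewrite big1 ?addr0 ?subrr // => j ji.
  by rewrite hornerZ lagrE eq_sym (negbTE ji) mulr0.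
- by rewrite map_inj_uniq // enum_uniq.
- rewrite size_map -cardE card_ord (leq_trans (size_polyD _ _)) // geq_max szp.
  rewrite size_polyN (leq_trans (size_sum _ _ _)) //; apply/bigmax_leqP => j _.
  by rewrite (leq_trans (size_scale_leq _ _)) // size_lagr.
Qed.

Definition gweight j := pint (lagr j).
Definition gquad (p : {poly R}) := \sum_(j < J) gweight j * p.[s j].

(** Reduction modulo [nodal] does not change values at the nodes, and interpolation reproduces the
    remainder exactly. *)
Lemma gquadE p : gquad p = pint (p %% nodal).
Proof.
have szm : (size (p %% nodal)%R <= J)%N.
  by rewrite -ltnS -size_nodal ltn_modp nodal_neq0.
rewrite [in RHS](lagrange_interp szm) linear_sum /=; apply: eq_bigr => j _.
rewrite linearZ /= mulrC; congr (_ * _).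
by rewrite [in LHS](divp_eq p nodal) hornerD hornerM horner_nodal mulr0 add0r.
Qed.

Hypothesis nodal_comp_opp : nodal \Po - 'X = (-1) ^+ J *: nodal.

(** As [nodal] has a parity, reduction modulo it commutes with [x |-> - x]; the remainder of an odd
    polynomial is thus odd and integrates to zero. *)
Lemma gquad_odd p : p \Po - 'X = - p -> gquad p = 0.
Proof.
move=> odd_p; rewrite gquadE; apply: pint_odd.
have sN : size (- 'X : {poly R}) = 2 by rewrite size_polyN size_polyX.
have szm : (size ((p %% nodal) \Po - 'X) < size nodal)%N.
  by rewrite size_comp_poly2 // ltn_modp nodal_neq0.
have := congr1 (fun q => q \Po - 'X) (divp_eq p nodal).
rewrite /= odd_p rmorphD rmorphM /= nodal_comp_opp -scalerAr scalerAl => /esym h.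
by rewrite -modpN -h modp_addl_mul_small.
Qed.

(** By parity [nodal] factors over the nodes and over their opposites; comparing the second
    coefficients of both products gives the claim. It makes the total evolution time exactly
    [J T / 2]. *)
Lemma sum_nodes : \sum_(j < J) s j = 0.
Proof.
have [J0|J0] := posnP J; first rewrite big1 // => j.
  by have : (j < 0)%N := leq_trans (ltn_ord j) (eq_leq J0).
set t := [seq s j | j <- enum 'I_J].
have st : size t = J by rewrite size_map -cardE card_ord.
have tE : \sum_(j < J) s j = \sum_(x <- t) x by rewrite big_map big_enum.
have h : \prod_(x <- t) ('X - x%:P) = \prod_(x <- [seq - x | x <- t]) ('X - x%:P).
  apply: (scalerI (_ : (-1) ^+ J != 0 :> R)); first by rewrite signr_eq0.
  rewrite -{1}nodalE -nodal_comp_opp nodalE -/t rmorph_prod big_map -st /=.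
  elim: (t) => [|x r IH]; rewrite ?big_nil ?scale1r // !big_cons IH /=.
  rewrite rmorphB /= comp_polyX comp_polyC polyCN exprS -!mul_polyC polyCM polyCN.
  ring.
have st0 : size t != 0 by rewrite st -lt0n.
have := coefPn_prod_XsubC st0; rewrite h.
have st' : size [seq - x | x <- t] = size t by rewrite size_map.
rewrite -{1}st' coefPn_prod_XsubC ?st' // => /oppr_inj.
by rewrite big_map sumrN -tE => /oppr_fix_eq0.
Qed.

Hypothesis nodal_orth : forall q : {poly R}, (size q <= J)%N -> pint (q * nodal) = 0.

(** In the division of [p] by [nodal] the quotient has size at most [J], so orthogonality kills its
    contribution to the integral. *)
Lemma gquad_exact (p : {poly R}) : (size p <= 2 * J)%N -> gquad p = pint p.
Proof.
move=> szp; rewrite gquadE [in RHS](divp_eq p nodal) linearD /= nodal_orth ?add0r //.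
by rewrite size_divp ?nodal_neq0 // size_nodal /= leq_subLR addnn -mul2n.
Qed.
End GaussRule.

(** * Existence of the Gauss-Legendre rule for the Lebesgue integral *)

Section RealIntegral.
Variable R : realType.

Lemma integral_poly (p : {poly R}) :
  (\int[lebesgue_measure]_(x in `[(-1)%R, 1%R]%classic) (p.[x])%:E)%E = (pint p)%:E.
Proof.
have [q ->] := antiderivative p.
rewrite (@continuous_FTC2 _ _ (horner q)) ?pint_deriv ?EFinB //.
- by apply: continuous_subspaceT; exact: continuous_horner.
- split.
  + by move=> x _; exact: derivable_horner.
  + exact/cvg_at_right_filter/continuous_horner.
  + exact/cvg_at_left_filter/continuous_horner.
- by move=> x _; rewrite -derivE.
Qed.

Lemma pint_ge0 (p : {poly R}) : (forall x, 0 <= p.[x]) -> 0 <= pint p.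
Proof.
move=> p0; rewrite -lee_fin -integral_poly; apply: integral_ge0 => x _.
by rewrite lee_fin.
Qed.

Theorem gauss_legendre_exists J : exists s w : 'I_J -> R,
  [/\ gauss_legendre s w, \sum_(j < J) s j = 0, (forall j, 0 <= w j),
    forall p : {poly R}, (size p <= 2 * J)%N -> \sum_(j < J) w j * p.[s j] = pint p
    & forall p : {poly R}, p \Po - 'X = - p -> \sum_(j < J) w j * p.[s j] = 0].
Proof.
have [t [st ut lt rt]] := rodrigues_roots R J.
pose s (j : 'I_J) := t`_j.
have s_inj : injective s.
  move=> i j /eqP; rewrite nth_uniq ?st ?ltn_ord // => /eqP; exact: val_inj.
have smem j : s j \in t by rewrite mem_nth // st.
pose W := (('X ^+ 2 - 1) ^+ J : {poly R})^`(J).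
(* [W] has size [J + 1] and the [J] distinct roots [t], so it is a scalar multiple of [nodal s] and
   passes its parity and orthogonality on. *)
have nodE : W = lead_coef W *: nodal s.
  rewrite [LHS](@all_roots_prod_XsubC _ W t) ?size_rodrigues ?st //; last by rewrite uniq_rootsE.
  congr (_ *: _); rewrite /nodal (big_nth 0) st big_mkord //.
have lW : lead_coef W != 0 by rewrite lead_coef_eq0 -size_poly_eq0 size_rodrigues.
have nodE' : nodal s = (lead_coef W)^-1 *: W by rewrite {2}nodE scalerA mulVf // scale1r.
have nodal_opp : nodal s \Po - 'X = (-1) ^+ J *: nodal s.
  by rewrite nodE' linearZ /= rodrigues_comp_opp !scalerA mulrC.
have nodal_orth (q : {poly R}) : (size q <= J)%N -> pint (q * nodal s) = 0.
  by move=> szq; rewrite nodE' -scalerAr linearZ /= pint_rodrigues_orth ?mulr0.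
exists s, (gweight s).
have exact p := @gquad_exact _ _ _ s_inj nodal_orth p.
split.
- split=> //; split.
    by move=> j; have /(allP lt)/andP[/ltW -> /ltW ->] := smem j.
  split.
    move=> j; rewrite /legendre rootZ; first exact: (allP rt _ (smem j)).
    by rewrite invr_eq0 pnatr_eq0 -lt0n muln_gt0 expn_gt0 fact_gt0.
  by move=> p szp; rewrite integral_poly -(exact p szp).
- exact: sum_nodes.
(* The square of a Lagrange polynomial has degree [2 J - 2], within the range of exactness, and is 1
   at its own node and 0 at the others: each weight is the integral of a square. *)
- move=> j; have -> : gweight s j = gquad s (lagr s j ^+ 2).
    rewrite /gquad (bigD1 j) //= big1 ?addr0; last first.
      by move=> i ij; rewrite horner_exp lagrE // (negbTE ij) expr0n mulr0.
    by rewrite horner_exp lagrE // eqxx expr1n mulr1.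
  rewrite exact; first by apply: pint_ge0 => x; rewrite horner_exp sqr_ge0.
  rewrite (leq_trans (size_poly_exp_leq _ _)) //.
  by have := size_lagr s j; have := ltn_ord j; lia.
- exact: exact.
- exact: gquad_odd.
Qed.
End RealIntegral.

(** * The complex exponential *)

Arguments cexp : simpl never.

Section ComplexExp.
Variable R : realType.
Local Notation C := R[i].
Local Notation normc := (@Normc.normc R).
Implicit Types z w v : C.

Lemma toCE (x : R) : toC x = (x%:C)%C. Proof. by []. Qed.

Lemma normCE z : `|z| = ((normc z)%:C)%C.
Proof. by rewrite normc_def; case: z. Qed.

Lemma reCM z w : reC (z * w) = reC z * reC w - imC z * imC w.
Proof. by case: z w => [a b] [c d]. Qed.

Lemma imCM z w : imC (z * w) = reC z * imC w + imC z * reC w.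
Proof. by case: z w => [a b] [c d]. Qed.

Lemma reCD z w : reC (z + w) = reC z + reC w.
Proof. by case: z w => [a b] [c d]. Qed.

Lemma imCD z w : imC (z + w) = imC z + imC w.
Proof. by case: z w => [a b] [c d]. Qed.

Lemma reCMn z n : reC (z *+ n) = reC z *+ n.
Proof. by elim: n => [|n IH]; rewrite ?mulr0n // !mulrS reCD IH. Qed.

Lemma reC_sum n (f : nat -> C) :
  reC (\sum_(i < n) f i) = \sum_(i < n) reC (f i).
Proof. exact: (big_morph (@reC R) reCD erefl). Qed.

Lemma reCN z : reC (- z) = - reC z. Proof. by case: z. Qed.
Lemma imCN z : imC (- z) = - imC z. Proof. by case: z. Qed.

Lemma normc_ge0 z : 0 <= normc z.
Proof. by case: z => a b; exact: sqrtr_ge0. Qed.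

Lemma sqr_normc z : normc z ^+ 2 = reC z ^+ 2 + imC z ^+ 2.
Proof. by case: z => a b; rewrite sqr_sqrtr // addr_ge0 ?sqr_ge0. Qed.

Lemma reC_le_normc z : `|reC z| <= normc z.
Proof.
by rewrite -ler_sqr ?nnegrE ?normc_ge0 // real_normK ?num_real // sqr_normc lerDl sqr_ge0.
Qed.

Lemma imC_le_normc z : `|imC z| <= normc z.
Proof.
by rewrite -ler_sqr ?nnegrE ?normc_ge0 // real_normK ?num_real // sqr_normc lerDr sqr_ge0.
Qed.

Lemma normc_toC (x : R) : normc (toC x) = `|x|.
Proof. by rewrite /= expr0n addr0 sqrtr_sqr. Qed.

Lemma cexpD z w : cexp (z + w) = cexp z * cexp w.
Proof.
rewrite /cexp reCD imCD expRD cosD sinD.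
apply/eqP; rewrite eq_complex /=; apply/andP; split; apply/eqP; ring.
Qed.

Lemma cexp0 : cexp 0 = 1 :> C.
Proof. by rewrite /cexp /= expR0 cos0 sin0 mulr0 mul1r. Qed.

Lemma normc_cexp z : normc (cexp z) = expR (reC z).
Proof.
rewrite /cexp /= !exprMn -mulrDr cos2Dsin2 mulr1 sqrtr_sqr.
by rewrite gtr0_norm ?expR_gt0.
Qed.

Definition exp_sum (n : nat) z : C := \sum_(m < n) z ^+ m / m`!%:R.

(** Multiplying by [v] and taking the real part reduces complex differentiation along [t |-> t z] to
    calculus on real functions. *)
Lemma is_derive_cexp z v (t : R) :
  is_derive t (1 : R) (fun u => reC (v * cexp (toC u * z)))
    (reC (v * z * cexp (toC t * z))).
Proof.
case: v z => [a b] [x y].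
have ex (u : R) : is_derive u (1 : R) (fun t => t * x) x.
  by apply: is_derive_eq; rewrite scaler0 add0r /GRing.scale /= mulr1.
have ey (u : R) : is_derive u (1 : R) (fun t => t * y) y.
  by apply: is_derive_eq; rewrite scaler0 add0r /GRing.scale /= mulr1.
have -> : (fun u => reC (Complex a b * cexp (toC u * Complex x y))) =
  fun t => a * (expR (t * x) * cos (t * y))
   - b * (expR (t * x) * sin (t * y)).
  by apply/funext => u; rewrite /cexp /= !mul0r subr0 addr0.
have h1 := @is_derive1_comp _ expR (fun t => t * x) t _ _ (is_derive_expR _) (ex t).
have h2 := @is_derive1_comp _ cos (fun t => t * y) t _ _ (is_derive_cos _) (ey t).
have h3 := @is_derive1_comp _ sin (fun t => t * y) t _ _ (is_derive_sin _) (ey t).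
apply: is_derive_eq; rewrite /cexp /= !mul0r subr0 addr0 /GRing.scale /=; ring.
Qed.

(** * Taylor remainder of the complex exponential *)

Section Taylor.
Variable z : C.

(** [g v] follows one real component, selected by [v], of the exponential along the segment from 0
    to [z]; [P n v] is its Taylor polynomial at 0. *)
Let g v (t : R) := reC (v * cexp (toC t * z)).
Let P n v : {poly R} := \poly_(m < n) reC (v * (z ^+ m / m`!%:R)).

Lemma taylor_poly_deriv n v : (P n.+1 v)^`() = P n (v * z).
Proof.
apply/polyP => i; rewrite coef_deriv !coef_poly ltnS; case: ifP => _; last by rewrite mul0rn.
have -> : v * z * (z ^+ i / i`!%:R) = (v * (z ^+ i.+1 / i.+1`!%:R)) *+ i.+1.
  rewrite factS natrM exprS -mulr_natr; field.
  by rewrite nat1r !pnatr_eq0 /= -lt0n fact_gt0.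
by rewrite reCMn.
Qed.

(** The derivative of the remainder of order [n + 1] for [v] is the remainder of order [n] for
    [v * z]. By induction, bound minus remainder is nondecreasing on [[0, 1]], and it vanishes at
    0. *)
Lemma taylor_dir_bound n v t : 0 <= t <= 1 ->
  g v t - (P n v).[t] <= expR `|reC z| * normc v * (normc z ^+ n * t ^+ n / n`!%:R).
Proof.
elim: n v t => [|n IH] v t /andP[t0 t1].
  rewrite /P poly_def big_ord0 hornerC subr0 !expr0 mul1r divr1 mulr1.
  rewrite /g (le_trans (ler_norm _)) // (le_trans (reC_le_normc _)) //.
  rewrite Normc.normcM mulrC ler_wpM2r ?normc_ge0 // normc_cexp ler_expR.
  rewrite reCM /= mul0r subr0 (le_trans (ler_norm _)) // normrM (ger0_norm t0).
  by rewrite ler_piMl.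
pose K := expR `|reC z| * normc v.
pose Q : {poly R} := (K * normc z ^+ n.+1 / n.+1`!%:R) *: 'X^(n.+1) + P n.+1 v.
pose f (u : R) := Q.[u] - g v u.
have df (u : R) : is_derive u (1 : R) f (Q^`().[u] - g (v * z) u).
  by apply: is_deriveB; exact: is_derive_cexp.
have f0 : f 0 = 0.
  rewrite /f /Q hornerD hornerZ hornerXn expr0n mulr0 add0r horner_coef0 coef_poly /=.
  rewrite expr0 divr1 mulr1 /g.
  have -> : toC 0 * z = 0 :> C by rewrite toCE rmorph0 mul0r.
  by rewrite cexp0 mulr1 subrr.
suff : f 0 <= f t.
  rewrite f0 /f /Q hornerD hornerZ hornerXn subr_ge0 => h.
  rewrite lerBlDr (le_trans h) // lerD2r le_eqVlt; apply/orP; left; apply/eqP.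
  by rewrite /K; ring.
apply: (@ger0_derive1_ndecr _ f 0 1) => //.
- move=> u; rewrite in_itv /= => /andP[u0 u1].
  have [_ dv] := df u; rewrite derive1E dv /Q derivD derivZ derivXn hornerD taylor_poly_deriv.
  have := IH (v * z) u; rewrite (ltW u0) (ltW u1) => /(_ isT).
  rewrite lerBlDr => h; rewrite subr_ge0 (le_trans h) // lerD2r.
  rewrite hornerZ hornerMn hornerXn /= Normc.normcM /K factS natrM exprS.
  rewrite le_eqVlt; apply/orP; left; apply/eqP; rewrite -mulr_natr; field.
  by rewrite nat1r !pnatr_eq0 /= -lt0n fact_gt0.
- by apply: derivable_within_continuous => u _; have [] := df u.
Qed.
End Taylor.

Lemma cexp_taylor n z :
  normc (cexp z - exp_sum n z) <= expR (normc z) * (normc z ^+ n / n`!%:R).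
Proof.
set r := cexp z - exp_sum n z.
have [r0|r0] := eqVneq (normc r) 0.
  by rewrite r0 mulr_ge0 ?expR_ge0 // divr_ge0 ?exprn_ge0 ?normc_ge0.
have rp : 0 < normc r by rewrite lt_def r0 normc_ge0.
(* Choosing [v] as the conjugate of the remainder [r] makes the directional remainder
   [normc r ^+ 2], and one factor [normc r] cancels. *)
have := @taylor_dir_bound z n (conjc r) 1; rewrite ler01 lexx => /(_ isT).
have -> : toC 1 * z = z by rewrite toCE rmorph1 mul1r.
have -> : (\poly_(m < n) reC (conjc r * (z ^+ m / m`!%:R))).[1] = reC (conjc r * exp_sum n z).
  rewrite horner_poly /exp_sum mulr_sumr.
  rewrite (reC_sum n (fun i => conjc r * (z ^+ i / i`!%:R))).
  by apply: eq_bigr => i _; rewrite expr1n mulr1.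
have -> : reC (conjc r * cexp z) - reC (conjc r * exp_sum n z) = normc r ^+ 2.
  by rewrite -reCN -reCD -mulrBr -/r sqr_normc reCM; case: r {r0 rp} => a b /=; ring.
have -> : normc (conjc r) = normc r by case: r {r0 rp} => a b /=; rewrite sqrrN.
rewrite expr1n mulr1 expr2 mulrAC mulrC [X in _ <= X]mulrC ler_pM2l // => h.
rewrite (le_trans h) // ler_wpM2r ?ler_expR ?reC_le_normc //.
by rewrite divr_ge0 ?exprn_ge0 ?normc_ge0.
Qed.

Lemma exp_coeff_cvg0 (x : R) : ((fun n => x ^+ n / n`!%:R) @ \oo --> 0)%classic.
Proof. exact: cvg_series_cvg_0 (is_cvg_series_exp_coeff x). Qed.

Lemma exp_tail_small (x e : R) : 0 < e ->
  exists N, forall n, (N <= n)%N -> expR x * (x ^+ n / n`!%:R) < e.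
Proof.
move=> e0.
have h : ((fun n => expR x * (x ^+ n / n`!%:R)) @ \oo --> (expR x * 0))%classic.
  by apply: cvgMr; exact: exp_coeff_cvg0.
rewrite mulr0 in h.
have /cvgrPdist_lt/(_ e e0) [N _ HN] := h.
exists N => n Nn; have := HN n Nn; rewrite /= sub0r normrN.
exact/le_lt_trans/ler_norm.
Qed.

(** Componentwise convergence matches [mxexp], whose entries are separate limits of real and
    imaginary parts. *)
Definition ccvg (u : nat -> C) (l : C) :=
  (((fun n => reC (u n)) @ \oo --> reC l) /\ ((fun n => imC (u n)) @ \oo --> imC l))%classic.

Lemma ccvg_exp_sum z : ccvg (exp_sum^~ z) (cexp z).
Proof.
have h : ((fun n => expR (normc z) * (normc z ^+ n / n`!%:R)) @ \oo --> (expR (normc z) * 0))%classic.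
  by apply: cvgMr; exact: exp_coeff_cvg0.
rewrite mulr0 in h.
split; apply/cvgrPdist_lt => e e0; have /cvgrPdist_lt/(_ e e0) := h;
  apply: filterS => n; rewrite /= sub0r normrN => hn.
- rewrite -[X in X < _]/(`|reC (cexp z) - reC (exp_sum n z)|) -reCN -reCD.
  rewrite (le_lt_trans (reC_le_normc _)) // (le_lt_trans (cexp_taylor _ _)) //.
  exact/le_lt_trans/hn/ler_norm.
- rewrite -[X in X < _]/(`|imC (cexp z) - imC (exp_sum n z)|) -imCN -imCD.
  rewrite (le_lt_trans (imC_le_normc _)) // (le_lt_trans (cexp_taylor _ _)) //.
  exact/le_lt_trans/hn/ler_norm.
Qed.

Lemma ccvgMl c (u : nat -> C) l : ccvg u l -> ccvg (fun n => c * u n) (c * l).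
Proof.
move=> [h1 h2]; split.
- under eq_fun do rewrite reCM.
  by rewrite reCM; apply: cvgB; apply: cvgMr.
- under eq_fun do rewrite imCM.
  by rewrite imCM; apply: cvgD; apply: cvgMr.
Qed.

Lemma ccvg_sum (I : Type) (r : seq I) (u : I -> nat -> C) (l : I -> C) :
  (forall i, ccvg (u i) (l i)) ->
  ccvg (fun n => \sum_(i <- r) u i n) (\sum_(i <- r) l i).
Proof.
move=> h; elim: r => [|i r IH].
  by under eq_fun do rewrite big_nil; rewrite big_nil; split; apply: cvg_cst.
under eq_fun do rewrite big_cons; rewrite big_cons.
have [h1 h2] := h i; have [h3 h4] := IH; split.
- under eq_fun do rewrite reCD.
  by rewrite reCD; apply: cvgD.
- under eq_fun do rewrite imCD.
  by rewrite imCD; apply: cvgD.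
Qed.

End ComplexExp.

(** * Functional calculus of Hermitian matrices *)

Section VectorNorm.
Variable R : realType.
Local Notation C := R[i].
Local Notation normc := (@Normc.normc R).

Lemma vnorm2_sqr (N : nat) (v : 'cV[C]_N) :
  toC (vnorm2 v ^+ 2) = \sum_(i < N) (v i 0)^* * v i 0.
Proof.
rewrite /vnorm2 sqr_sqrtr; last by apply: sumr_ge0 => i _; rewrite exprn_ge0 // normc_ge0.
rewrite toCE rmorph_sum; apply: eq_bigr => i _.
by rewrite rmorphXn /= -normCE normCKC.
Qed.

Lemma vnorm2_ge0 (N : nat) (v : 'cV[C]_N) : 0 <= vnorm2 v.
Proof. exact: sqrtr_ge0. Qed.

Lemma vnorm2_unitary (N : nat) (U : 'M[C]_N) (v : 'cV[C]_N) :
  map_mx Num.conj U^T *m U = 1%:M -> vnorm2 (U *m v) = vnorm2 v.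
Proof.
move=> UU; apply/eqP; rewrite -(@eqrXn2 _ 2) ?vnorm2_ge0 //; apply/eqP/(@complexI R).
have dot (w : 'cV[C]_N) : toC (vnorm2 w ^+ 2) = (map_mx Num.conj w^T *m w) 0 0.
  by rewrite vnorm2_sqr mxE; apply: eq_bigr => i _; rewrite !mxE.
rewrite -!toCE !dot trmx_mul map_mxM /= -mulmxA (mulmxA _ U) UU mul1mx //.
Qed.

Lemma opnorm2_le (N : nat) (A : 'M[C]_N) (M : R) : (0 < N)%N ->
  (forall v, vnorm2 (A *m v) <= M * vnorm2 v) -> opnorm2 A <= M.
Proof.
case: N A => // N A _ h; apply: ge_sup.
  (* The supremum needs a nonempty unit sphere; the first basis vector exists because [0 < N]. *)
  exists (vnorm2 (A *m delta_mx 0 0)); exists (delta_mx 0 0) => //=.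
  rewrite /vnorm2 (bigD1 ord0) //= big1 ?addr0.
    by rewrite mxE eqxx Normc.normc1 expr1n sqrtr1.
  by move=> i i0; rewrite mxE (negbTE i0) Normc.normc0 expr0n.
by move=> _ [v /= v1 <-]; rewrite -[M]mulr1 -v1.
Qed.
End VectorNorm.

Section SpectralCalculus.
Variable R : realType.
Local Notation C := R[i].
Local Notation normc := (@Normc.normc R).
Variables (N : nat) (P : 'M[C]_N).
Hypothesis Punit : P \in unitmx.
Implicit Types f g : 'I_N -> C.

(** Functional calculus with a fixed eigenbasis: once [H] has this form, so do its resolvent and its
    evolutions, and matrix algebra becomes pointwise algebra on eigenvalues. *)
Definition conjdiag f : 'M[C]_N := invmx P *m diag_mx (\row_i f i) *m P.

Lemma conjdiagE f i j : conjdiag f i j = \sum_(l < N) invmx P i l * P l j * f l.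
Proof.
rewrite mxE; apply: eq_bigr => l _; rewrite mul_mx_diag !mxE; ring.
Qed.

Lemma conjdiagM f g : conjdiag f *m conjdiag g = conjdiag (fun i => f i * g i).
Proof.
have h (D : 'M[C]_N) : P *m (invmx P *m D *m P) = D *m P.
  by rewrite -mulmxA mulKVmx.
rewrite /conjdiag -[LHS]mulmxA h mulmxA -(mulmxA (invmx P) (diag_mx _) (diag_mx _)).
rewrite mulmx_diag (_ : \row_j _ = \row_i (f i * g i)) //.
by apply/rowP => i; rewrite !mxE.
Qed.

Lemma conjdiag_const c : conjdiag (fun=> c) = c%:M.
Proof.
have -> : conjdiag (fun=> c) = invmx P *m (c *: P).
  rewrite /conjdiag -mulmxA -mul_scalar_mx; congr (_ *m (_ *m _)).
  by rewrite -diag_const_mx; congr diag_mx; apply/rowP => i; rewrite !mxE.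
by rewrite -scalemxAr mulVmx // scalemx1.
Qed.

Lemma conjdiagB f g : conjdiag f - conjdiag g = conjdiag (fun i => f i - g i).
Proof.
rewrite /conjdiag -mulmxBl -mulmxBr -linearB /=.
rewrite (_ : _ - _ = \row_i (f i - g i)) //.
by apply/rowP => i; rewrite !mxE.
Qed.

Lemma conjdiagZ c f : c *: conjdiag f = conjdiag (fun i => c * f i).
Proof.
rewrite /conjdiag scalemxAl scalemxAr -linearZ /=.
rewrite (_ : c *: _ = \row_i (c * f i)) //.
by apply/rowP => i; rewrite !mxE.
Qed.

Lemma conjdiag_sum n (F : 'I_n -> 'I_N -> C) :
  \sum_(k < n) conjdiag (F k) = conjdiag (fun i => \sum_(k < n) F k i).
Proof.
apply/matrixP => i j; rewrite [LHS]summxE [RHS]conjdiagE.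
under eq_bigr do rewrite conjdiagE.
by rewrite exchange_big; apply: eq_bigr => l _; rewrite mulr_sumr.
Qed.

Lemma eq_conjdiag f g : f =1 g -> conjdiag f = conjdiag g.
Proof. by move=> /funext ->. Qed.

Lemma mxpow_conjdiag f m : mxpow (conjdiag f) m = conjdiag (fun i => f i ^+ m).
Proof.
elim: m => [|m IH]; first by rewrite -[LHS]conjdiag_const.
rewrite /mxpow iterS -/(mxpow _ m) IH conjdiagM.
by apply: eq_conjdiag => i; rewrite exprS.
Qed.

(** Each entry of a partial sum is a fixed finite combination of scalar partial sums, so convergence
    passes to the limit entrywise. *)
Lemma mxexp_conjdiag f : mxexp (conjdiag f) = conjdiag (fun i => cexp (f i)).
Proof.
have partial k : mxexp_partial (conjdiag f) k = conjdiag (fun i => exp_sum k (f i)).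
  rewrite /mxexp_partial.
  under eq_bigr do rewrite mxpow_conjdiag conjdiagZ.
  rewrite conjdiag_sum; apply: eq_conjdiag => i; apply: eq_bigr => m _.
  by rewrite mulrC toCE fmorphV rmorph_nat.
apply/matrixP => i j; rewrite mxE.
have [h1 h2] : ccvg (fun k => mxexp_partial (conjdiag f) k i j)
    (conjdiag (fun i => cexp (f i)) i j).
  under eq_fun do rewrite partial conjdiagE.
  rewrite conjdiagE; apply: ccvg_sum => l.
  exact/ccvgMl/ccvg_exp_sum.
rewrite (cvg_lim _ h1) ?(cvg_lim _ h2) //.
by case: (conjdiag _ i j).
Qed.

Lemma invmx_conjdiag f : (forall i, f i != 0) ->
  invmx (conjdiag f) = conjdiag (fun i => (f i)^-1).
Proof.
move=> f0.
have h : conjdiag f *m conjdiag (fun i => (f i)^-1) = 1%:M.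
  rewrite conjdiagM -conjdiag_const; apply: eq_conjdiag => i.
  by rewrite mulfV.
have [u _] := mulmx1_unit h.
by rewrite -[RHS](mulKmx u) h mulmx1.
Qed.

Hypothesis Pinv : invmx P = map_mx Num.conj P^T.

(** Both unitary factors preserve [vnorm2], which leaves a diagonal matrix to be bounded entry by
    entry. *)
Lemma opnorm2_conjdiag f (M : R) : (0 < N)%N ->
  (forall i, normc (f i) <= M) -> opnorm2 (conjdiag f) <= M.
Proof.
move=> N0 fM; apply: opnorm2_le => // v.
have M0 : 0 <= M by apply: le_trans (fM (Ordinal N0)); rewrite normc_ge0.
have -> : vnorm2 (conjdiag f *m v) = vnorm2 (diag_mx (\row_i f i) *m (P *m v)).
  rewrite /conjdiag -!mulmxA vnorm2_unitary //.
  rewrite Pinv map_trmx trmxK -map_mx_comp map_mx_id; last exact: conjCK.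
  by rewrite -Pinv mulmxV.
have <- : vnorm2 (P *m v) = vnorm2 v.
  by rewrite vnorm2_unitary // -Pinv mulVmx.
move: (P *m v) => w.
rewrite -(@ler_pXn2r _ 2) ?nnegrE ?vnorm2_ge0 ?mulr_ge0 ?vnorm2_ge0 //.
rewrite exprMn /vnorm2 !sqr_sqrtr; try by apply: sumr_ge0 => i _; rewrite exprn_ge0 // normc_ge0.
rewrite mulr_sumr; apply: ler_sum => i _.
rewrite mul_diag_mx !mxE Normc.normcM exprMn ler_wpM2r ?exprn_ge0 ?normc_ge0 //.
by rewrite ler_pXn2r ?nnegrE ?normc_ge0.
Qed.
End SpectralCalculus.

(** Row [i] of the spectral matrix is a left eigenvector, so each diagonal entry is a root of the
    characteristic polynomial; [e] picks an index for it. *)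
Lemma hermitian_conjdiag (R : realType) (N : nat) (H : 'M[R[i]]_N) (E : 'I_N -> R) :
  is_hermitian_mx H ->
  char_poly H = \prod_(n < N) ('X - (toC (E n))%:P) ->
  exists P : 'M[R[i]]_N, exists e : 'I_N -> 'I_N,
    [/\ P \in unitmx, invmx P = map_mx Num.conj P^T
      & H = conjdiag P (fun i => toC (E (e i)))].
Proof.
move=> Hh Hc.
have herm : H \is hermsymmx.
  apply/is_hermitianmxP; rewrite expr0 scale1r.
  by apply/matrixP => i j; rewrite !mxE; apply: Hh.
have := hermitian_normalmx herm => /orthomx_spectralP.
have := spectral_unit H; have := spectral_unitarymx H.
move: (spectralmx H) (spectral_diag H) => P d uP Pu HE.
have root_d i : exists n, d 0 i = toC (E n).
  have : eigenvalue H (d 0 i).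
    apply/eigenvalueP; exists (row i P).
      rewrite {1}HE !mulmxA -row_mul mulmxV // row1 -rowE.
      by rewrite row_diag_mx -scalemxAl -rowE.
    apply/negP => /eqP r0.
    have := congr1 (row i) (mulmxV Pu); rewrite row_mul r0 mul0mx row1 => /rowP /(_ i).
    by rewrite !mxE !eqxx => /eqP; rewrite eq_sym oner_eq0.
  rewrite eigenvalue_root_char Hc /root horner_prod prodf_seq_eq0 => /hasP[n _ /=].
  by rewrite !hornerE subr_eq0 => /eqP h; exists n.
have [e He] := choice root_d.
exists P, e; split; [exact: Pu|exact: invmx_unitary|].
have dE : d = \row_i toC (E (e i)) by apply/rowP => i; rewrite mxE He.
by subst d; exact: HE.
Qed.

(** * The quadrature error for exponentials *)

Section QuadratureError.
Variable R : realType.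
Local Notation C := R[i].
Local Notation normc := (@Normc.normc R).
Variables (J : nat) (s w : 'I_J -> R).

Definition quad_err (p : {poly C}) : C^o :=
  \sum_(j < J) toC (w j) * p.[toC (s j)] - pint p.

Lemma quad_err_is_scalar : scalar quad_err.
Proof.
move=> k p q; rewrite /quad_err linearP /= opprD mulrBr.
have -> : \sum_(j < J) toC (w j) * (k *: p + q).[toC (s j)] =
  k * (\sum_(j < J) toC (w j) * p.[toC (s j)]) + \sum_(j < J) toC (w j) * q.[toC (s j)].
  rewrite mulr_sumr -big_split /=; apply: eq_bigr => j _.
  by rewrite hornerD hornerZ; ring.
ring.
Qed.

HB.instance Definition _ :=
  GRing.isLinear.Build C {poly C} C^o _ quad_err quad_err_is_scalar.

Hypothesis J0 : (0 < J)%N.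
Hypothesis nodes : forall j, -1 <= s j <= 1.
Hypothesis w0 : forall j, 0 <= w j.
Hypothesis exact_quad : forall p : {poly R}, (size p <= 2 * J)%N ->
  \sum_(j < J) w j * p.[s j] = pint p.
Hypothesis odd_quad : forall p : {poly R}, p \Po - 'X = - p ->
  \sum_(j < J) w j * p.[s j] = 0.

Lemma sum_weights : \sum_(j < J) w j = 2.
Proof.
have /exact_quad : (size (1%R : {poly R}) <= 2 * J)%N by rewrite size_poly1 muln_gt0.
have -> : pint (1 : {poly R}) = 2.
  by rewrite /pint size_poly1 big_ord1 coef1 /moment mul1r expr1 divr1 opprK.
by move=> <-; apply: eq_bigr => j _; rewrite hornerC mulr1.
Qed.

Lemma quad_err_real (p : {poly R}) : quad_err (map_poly (real_complex R) p) =
  toC (\sum_(j < J) w j * p.[s j] - pint p).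
Proof.
rewrite /quad_err pint_map toCE rmorphB; congr (_ - _); rewrite [RHS]rmorph_sum.
by apply: eq_bigr => j _; rewrite rmorphM /= horner_map.
Qed.

Lemma quad_err_chebT k : quad_err (chebT C k) =
  toC (\sum_(j < J) w j * (chebT R k).[s j] - pint (chebT R k)).
Proof. by rewrite -(map_chebT (real_complex R)) quad_err_real. Qed.

Lemma chebT_abs_le1 k (x : R) : -1 <= x <= 1 -> `|(chebT R k).[x]| <= 1.
Proof.
move=> /andP[x1 x2]; have := @chebT_norm_le1 C k (toC x).
rewrite -(map_chebT (real_complex R)) horner_map /= normCE.
rewrite -[Normc.normc _]/(normc (toC _)) normc_toC.
rewrite -(rmorph1 (real_complex R)) -rmorphN /= !lecR x1 x2; exact.
Qed.

Lemma chebT_quad_odd k : odd k ->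
  \sum_(j < J) w j * (chebT R k).[s j] = 0 /\ pint (chebT R k) = 0.
Proof.
move=> ok.
have h : chebT R k \Po - 'X = - chebT R k.
  by rewrite chebT_comp_opp -signr_odd ok scaleN1r.
by split; [exact: odd_quad|exact: pint_odd].
Qed.

(** The weights sum to 2 and [chebT] is at most 1 on the nodes; the integral adds at most
    [2 / 3]. *)
Lemma chebT_quad_bound k : (J.*2 <= k)%N ->
  `|\sum_(j < J) w j * (chebT R k).[s j] - pint (chebT R k)| <= 8 / 3.
Proof.
move=> Jk; have [ok|ek] := boolP (odd k).
  by have [-> ->] := chebT_quad_odd ok; rewrite subrr normr0 divr_ge0.
have k2 : (2 <= k)%N by lia.
have -> : 8 / 3 = 2 + 2 / 3 :> R by lra.
rewrite (le_trans (ler_normB _ _)) // lerD //.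
  rewrite (le_trans (ler_norm_sum _ _ _)) // -sum_weights; apply: ler_sum => j _.
  by rewrite normrM (ger0_norm (w0 j)) ler_piMr // chebT_abs_le1.
case: k k2 ek {Jk} => [|[|k]] // _; rewrite /= negbK; exact: pint_chebT_norm.
Qed.

Lemma quad_err_bound (p : {poly C}) (B : R) :
  (forall u : C, `|u| = sqrtC 2 -> normc p.[(u + u^-1) / 2] <= B) ->
  normc (quad_err p) <= 32 / 3 * B / 2 ^+ J.
Proof.
move=> hB; rewrite -lecR -normCE.
(* The factor 4 comes from [functional_bound], the factor [8 / 3] from [chebT_quad_bound]. *)
have -> : ((32 / 3 * B / 2 ^+ J)%:C)%C = 4 * toC (8 / 3) * toC B / 2 ^+ J.
  rewrite !toCE rmorphM rmorphM /= fmorphV rmorphXn /= rmorph_nat; congr (_ * _ / _).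
  by rewrite !rmorphM /= !fmorphV !rmorph_nat; field.
apply: functional_bound => //.
- move=> k kJ; apply: etrans (quad_err_chebT k) _.
  by rewrite exact_quad ?subrr // size_chebT mul2n.
- move=> k ok; apply: etrans (quad_err_chebT k) _.
  by have [-> ->] := chebT_quad_odd ok; rewrite subrr.
- move=> k kJ; rewrite -[X in `|X|]/(quad_err (chebT C k)) quad_err_chebT.
  by rewrite normCE normc_toC lecR chebT_quad_bound.
- by move=> u un; rewrite normCE lecR hB.
Qed.

Let taylor (mu : C) n : {poly C} := \poly_(m < n) (mu ^+ m / m`!%:R).

Lemma horner_taylor mu n x : (taylor mu n).[x] = exp_sum n (mu * x).
Proof.
rewrite horner_poly; apply: eq_bigr => m _; rewrite exprMn; ring.
Qed.

(** The Taylor version of the integral [(e^mu - e^(- mu)) / mu] of [e^(mu x)]; the factor [mu]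
    raises the order by one. *)
Lemma pint_taylor mu n :
  mu * pint (taylor mu n) = exp_sum n.+1 mu - exp_sum n.+1 (- mu).
Proof.
rewrite (@pint_wide _ n) ?size_poly // mulr_sumr /exp_sum.
rewrite -sumrB big_ord_recl /= !expr0 subrr add0r; apply: eq_bigr => m _.
rewrite coef_poly ltn_ord /moment /bump /= add1n factS natrM (exprNn mu) [mu ^+ _.+1]exprS.
field; rewrite nat1r !pnatr_eq0 /= -lt0n fact_gt0 //.
Qed.

(** A crude bound, serving only to fix a disc on which the Taylor remainder is uniformly small. *)
Lemma normc_ellipse (u : C) : `|u| = sqrtC 2 -> normc ((u + u^-1) / 2) <= 2.
Proof.
move=> un.
have u2 : normc u ^+ 2 = 2.
  apply: (@complexI R); rewrite rmorphXn /= -normCE un sqrtCK rmorph_nat //.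
have nu1 : 1 <= normc u.
  by rewrite -(@ler_pXn2r _ 2) ?nnegrE ?normc_ge0 ?ler01 // expr1n u2; lra.
have nu2 : normc u <= 2.
  by rewrite -(@ler_pXn2r _ 2) ?nnegrE ?normc_ge0 ?ler0n // u2; lra.
have nV : normc (u^-1) <= 1 by rewrite Normc.normcV invf_le1 // (lt_le_trans ltr01).
rewrite Normc.normcM.
have -> : normc 2^-1 = 2^-1.
  by rewrite Normc.normcV -(rmorph_nat (real_complex R)) normc_toC normr_nat.
rewrite ler_pdivrMr ?ltr0n // (le_trans (le_normcD _ _)) //; lra.
Qed.

Lemma gauss_exp_error (mu : C) (M : R) : mu != 0 ->
  (forall u : C, `|u| = sqrtC 2 -> normc (cexp (mu * ((u + u^-1) / 2))) <= M) ->
  normc (\sum_(j < J) toC (w j) * cexp (mu * toC (s j)) - (cexp mu - cexp (- mu)) / mu)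
    <= 32 / 3 * M / 2 ^+ J.
Proof.
move=> mu0 hM.
have nmu : 0 < normc mu.
  by rewrite lt_def normc_ge0 andbT; apply: contraNneq mu0 => /Normc.eq0_normc ->.
pose X := 2 * normc mu.
pose delta n := expR X * (X ^+ n / n`!%:R).
have hd n (y : C) : normc y <= X -> normc (cexp y - exp_sum n y) <= delta n.
  move=> yX; rewrite (le_trans (cexp_taylor n y)) //.
  rewrite ler_pM ?expR_ge0 ?ler_expR ?divr_ge0 ?exprn_ge0 ?normc_ge0 //.
  by rewrite ler_wpM2r ?invr_ge0 // lerXn2r ?nnegrE ?(le_trans (normc_ge0 _) yX) ?normc_ge0.
(* The three summands multiply the Taylor remainder on the ellipse, at the nodes and in the exact
   integral, so [e / K] is the accuracy to ask of it. *)
pose K : R := 32 / 3 + 2 + 2 / normc mu.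
have K0 : 0 < K by rewrite !addr_gt0 ?divr_gt0.
apply/ler_addgt0Pr => e e0.
have eK : 0 < e / K by rewrite divr_gt0.
have [n hn] := exp_tail_small X eK.
have dn : delta n < e / K by apply: hn.
have dn1 : delta n.+1 < e / K by apply: hn; rewrite leqnSn.
have muX : normc mu <= X by rewrite /X ler_peMl ?normc_ge0 ?ler1n.
have h1 : normc (quad_err (taylor mu n)) <= 32 / 3 * (M + delta n) / 2 ^+ J.
  apply: quad_err_bound => u un; rewrite horner_taylor.
  set y := mu * _.
  have -> : exp_sum n y = cexp y - (cexp y - exp_sum n y) by rewrite subKr.
  rewrite (le_trans (le_normcD _ _)) // normcN lerD ?hM //.
  by apply: hd; rewrite Normc.normcM /X mulrC ler_wpM2r ?normc_ge0 ?normc_ellipse.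
(* The error splits into that of the rule on the Taylor polynomial, the Taylor remainder at the
   nodes, and the Taylor remainder of the integral. *)
have -> : \sum_(j < J) toC (w j) * cexp (mu * toC (s j)) - (cexp mu - cexp (- mu)) / mu
  = quad_err (taylor mu n)
   + \sum_(j < J) toC (w j) * (cexp (mu * toC (s j)) - exp_sum n (mu * toC (s j)))
   - ((cexp mu - exp_sum n.+1 mu) - (cexp (- mu) - exp_sum n.+1 (- mu))) / mu.
  have -> : \sum_(j < J) toC (w j) * (cexp (mu * toC (s j)) - exp_sum n (mu * toC (s j)))
    = \sum_(j < J) toC (w j) * cexp (mu * toC (s j))
      - \sum_(j < J) toC (w j) * (taylor mu n).[toC (s j)].
    by rewrite -sumrB; apply: eq_bigr => j _; rewrite horner_taylor mulrBr.
  have -> : (cexp mu - exp_sum n.+1 mu) - (cexp (- mu) - exp_sum n.+1 (- mu)) =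
    cexp mu - cexp (- mu) - mu * pint (taylor mu n) by rewrite pint_taylor; ring.
  rewrite /quad_err; move: (pint _) (\sum_(j < J) _) (\sum_(j < J) _) (cexp mu) (cexp (- mu)) => x1 x2 x3 x4 x5.
  by field.
have h2 : normc (\sum_(j < J) toC (w j) *
    (cexp (mu * toC (s j)) - exp_sum n (mu * toC (s j)))) <= 2 * delta n.
  rewrite -lecR -normCE (le_trans (ler_norm_sum _ _ _)) //.
  rewrite -sum_weights mulr_suml rmorph_sum; apply: ler_sum => j _.
  rewrite normCE lecR Normc.normcM normc_toC (ger0_norm (w0 j)) ler_wpM2l //.
  apply: hd; rewrite Normc.normcM normc_toC (le_trans _ muX) // ler_piMr ?normc_ge0 //.
  by rewrite ler_norml.
have h3 : normc (((cexp mu - exp_sum n.+1 mu) - (cexp (- mu) - exp_sum n.+1 (- mu))) / mu)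
    <= 2 / normc mu * delta n.+1.
  rewrite Normc.normcM Normc.normcV mulrAC ler_wpM2r ?invr_ge0 ?normc_ge0 //.
  rewrite (le_trans (le_normcD _ _)) // normcN mulr_natl mulr2n lerD ?hd //.
  by rewrite normcN.
rewrite (le_trans (le_normcD _ _)) // normcN.
have h4 := le_normcD (quad_err (taylor mu n))
  (\sum_(j < J) toC (w j) * (cexp (mu * toC (s j)) - exp_sum n (mu * toC (s j)))).
have h5 : 32 / 3 * (M + delta n) / 2 ^+ J <= 32 / 3 * M / 2 ^+ J + 32 / 3 * (e / K).
  rewrite mulrDr mulrDl lerD2l ler_pdivrMr ?exprn_gt0 //.
  rewrite (@le_trans _ _ (32 / 3 * (e / K) * 1)) //.
    by rewrite mulr1 ler_wpM2l ?divr_ge0 // ltW.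
  rewrite ler_wpM2l ?mulr_ge0 ?divr_ge0 ?invr_ge0 ?(ltW e0) ?(ltW K0) //.
  by rewrite exprn_ege1 // ler1n.
have h6 : 2 / normc mu * delta n.+1 <= 2 / normc mu * (e / K).
  by rewrite ler_wpM2l ?divr_ge0 ?normc_ge0 // ltW.
have eE : e = 32 / 3 * (e / K) + 2 * (e / K) + 2 / normc mu * (e / K).
  by rewrite -!mulrDl -/K mulrC divfK // gt_eqF.
rewrite {}[in leRHS]eE.
lra.
Qed.

End QuadratureError.

(** * The error at one eigenvalue *)

Lemma toC_half (R : realType) : 2^-1 = toC 2^-1 :> R[i].
Proof. by rewrite toCE fmorphV rmorph_nat. Qed.

Section ScalarEstimate.
Variable R : realType.
Local Notation C := R[i].
Local Notation normc := (@Normc.normc R).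

(** For [|u| = sqrt 2] the inverse of [u] is half its conjugate, so the point of the ellipse has
    real part [3 / 4 Re u] and imaginary part [Im u / 4]. *)
Lemma exp_ellipse_bound (beta gamma : R) (u : C) : 0 <= beta -> `|u| = sqrtC 2 ->
  normc (cexp (Complex (- beta) gamma * ((u + u^-1) / 2)))
    <= expR (Num.sqrt 2 / 4 * (3 * beta + `|gamma|)).
Proof.
move=> b0 un; rewrite normc_cexp ler_expR.
have u2 : normc u ^+ 2 = 2.
  apply: (@complexI R); rewrite rmorphXn /= -normCE un sqrtCK rmorph_nat //.
have nu : normc u = Num.sqrt 2.
  by rewrite -u2 sqrtr_sqr ger0_norm ?normc_ge0.
have := reC_le_normc u; have := imC_le_normc u; rewrite nu.
have h : (u + u^-1) / 2 = Complex (3 / 4 * reC u) (imC u / 4).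
  have uV : u^-1 = Complex (reC u / 2) (- imC u / 2).
    rewrite invc_norm un -exprVn exprVn sqrtCK.
    rewrite toC_half; case: (u) => x y /=.
    by apply/eqP; rewrite eq_complex /=; apply/andP; split; apply/eqP; field.
  rewrite uV toC_half; case: (u) => x y /=.
  by apply/eqP; rewrite eq_complex /=; apply/andP; split; apply/eqP; field.
rewrite h reCM /=; move: (reC u) (imC u) => x y.
move=> hy hx; have s0 : 0 <= Num.sqrt 2 :> R by rewrite sqrtr_ge0.
have h1 : - beta * (3 / 4 * x) <= 3 / 4 * (beta * Num.sqrt 2).
  have : beta * - x <= beta * Num.sqrt 2.
    by rewrite ler_wpM2l // (le_trans _ hx) // -normrN ler_norm.
  lra.
have h2 : - (gamma * (y / 4)) <= `|gamma| * Num.sqrt 2 / 4.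
  have : - (gamma * y) <= `|gamma| * Num.sqrt 2.
    rewrite (le_trans (ler_norm _)) // normrN normrM ler_wpM2l //.
  lra.
lra.
Qed.

Lemma resolvent_scalar_error (J : nat) (s w : 'I_J -> R) (a b E T Q : R) :
  0 < b -> 0 < T ->
  let z : C := Complex a b in
  let mu : C := iC R * (z - toC E) * toC (T / 2) in
  normc (\sum_(j < J) toC (w j) * cexp (mu * toC (s j)) - (cexp mu - cexp (- mu)) / mu) <= Q ->
  normc ((z - toC E)^-1 - (- iC R * toC (T / 2)) *
     \sum_(j < J) (toC (w j) * cexp ((iC R * z) * toC (gl_times T s j)))
        * cexp ((- iC R * toC (gl_times T s j)) * toC E))
  <= expR (- (b * T)) / b + T / 2 * expR (- (b * T / 2)) * Q.
Proof.
move=> b0 T0 z mu hQ.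
have z0 : z - toC E != 0.
  rewrite eq_complex /= negb_and; apply/orP; right; rewrite subr0 gt_eqF //.
have i0 : iC R != 0 by rewrite eq_complex /= negb_and oner_eq0 orbT.
have T20 : toC (T / 2) != 0 :> C.
  by rewrite eq_complex /= negb_and gt_eqF ?divr_gt0.
have nz : b <= normc (z - toC E).
  by apply: le_trans (imC_le_normc _); rewrite /= subr0 ler_norm.
set S := \sum_(j < J) toC (w j) * cexp (mu * toC (s j)) in hQ *.
have -> : \sum_(j < J) (toC (w j) * cexp ((iC R * z) * toC (gl_times T s j)))
        * cexp ((- iC R * toC (gl_times T s j)) * toC E) = cexp mu * S.
  rewrite mulr_sumr; apply: eq_bigr => j _; rewrite -mulrA -cexpD mulrCA -cexpD.
  congr (_ * cexp _).
  have -> : toC (gl_times T s j) = toC (T / 2) * (1 + toC (s j)).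
    rewrite !toCE -(rmorph1 (real_complex R)) -rmorphD -rmorphM; congr (real_complex _ _).
    by rewrite /gl_times /=; field.
  by rewrite /mu; ring.
(* The first term is the tail of the resolvent integral beyond [T], since [cexp mu * cexp mu] has
   modulus [e^(- b T)]; the second is the scaled quadrature error. *)
have -> : (z - toC E)^-1 - (- iC R * toC (T / 2)) * (cexp mu * S) =
   cexp mu * cexp mu / (z - toC E)
   + iC R * toC (T / 2) * cexp mu * (S - (cexp mu - cexp (- mu)) / mu).
  have e1 : cexp mu * cexp (- mu) = 1 by rewrite -cexpD subrr cexp0.
  have -> : (cexp mu - cexp (- mu)) / mu = (cexp mu - cexp (- mu)) / (z - toC E) / (iC R * toC (T / 2)).
    by rewrite /mu; field; rewrite z0 i0 T20.
  rewrite -[X in X - _ = _]mul1r -e1; move: hQ e1 => _ _.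
  move: (cexp mu) (cexp (- mu)) (z - toC E) z0 (iC R) i0 (toC (T / 2)) T20 => x1 x2 x3 x30 x4 x40 x5 x50.
  by field; rewrite x30 x40 x50.
have remu : reC mu = - (b * T / 2).
  by rewrite /mu /z /= ; field.
rewrite (le_trans (le_normcD _ _)) // lerD //.
  rewrite !Normc.normcM Normc.normcV normc_cexp remu -expRD.
  have -> : - (b * T / 2) - (b * T / 2) = - (b * T) by lra.
  by rewrite ler_wpM2l ?expR_ge0 // lef_pV2 ?posrE // (lt_le_trans b0).
rewrite !Normc.normcM normc_cexp remu normc_toC.
have -> : normc (iC R) = 1 by rewrite /= expr0n expr1n add0r sqrtr1.
rewrite mul1r ger0_norm ?divr_ge0 ?(ltW T0) // ler_wpM2l //.
by rewrite mulr_ge0 ?expR_ge0 ?divr_ge0 ?(ltW T0).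
Qed.

(** The condition on [J] is exponentiated in base 2; the summand 3 becomes the factor 8. *)
Lemma node_count_bound (L eta : R) (J : nat) : 0 < L ->
  log2 L + (eta + 1) * log2 (expR L) + 3 <= J%:R ->
  8 * L * expR ((eta + 1) * L) <= 2 ^+ J.
Proof.
move=> L0; have l2 : 0 < ln 2 :> R by rewrite ln_gt0 // ltr1n.
rewrite /log2 expRK => h.
have : ln L + (eta + 1) * L + 3 * ln 2 <= J%:R * ln 2.
  rewrite -(ler_pM2r l2) in h; apply: le_trans h.
  by rewrite le_eqVlt; apply/orP; left; apply/eqP; field; rewrite gt_eqF.
have -> : 8 * L * expR ((eta + 1) * L) = expR (ln L + (eta + 1) * L + 3 * ln 2).
  by rewrite 2!expRD expRM_natl !lnK ?posrE //; ring.
have -> : 2 ^+ J = expR (J%:R * ln 2) :> R by rewrite expRM_natl lnK ?posrE.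
by rewrite ler_expR.
Qed.

End ScalarEstimate.

(** * Choice of the parameters *)

Section Constants.
Variable R : realType.

(** Rationalizing the denominator brings [eta] to the shape of the exponent in
    [exp_ellipse_bound]. *)
Lemma etaE (b aplus : R) : 0 < b ->
  (3 * b - 2 * Num.sqrt 2 * b + aplus) / (4 * Num.sqrt 2 * b) =
  Num.sqrt 2 / 8 * (3 + aplus / b) - 1 / 2.
Proof.
move=> b0; have s0 : 0 < Num.sqrt 2 :> R by rewrite sqrtr_gt0.
have s2 : Num.sqrt 2 * Num.sqrt 2 = 2 :> R by rewrite -expr2 sqr_sqrtr.
apply: (mulIf (_ : 4 * Num.sqrt 2 * b != 0)); first by rewrite gt_eqF ?mulr_gt0.
rewrite divfK; last by rewrite gt_eqF ?mulr_gt0.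
have -> : (Num.sqrt 2 / 8 * (3 + aplus / b) - 1 / 2) * (4 * Num.sqrt 2 * b) =
  (Num.sqrt 2 * Num.sqrt 2) / 2 * (3 * b + aplus) - 2 * Num.sqrt 2 * b.
  by field; rewrite gt_eqF.
by rewrite s2; field.
Qed.

Lemma quadrature_term_bound (b eps L eta x aplus : R) (J : nat) :
  0 < b -> 0 < eps -> 0 < L -> expR L = 2 / (eps * b) ->
  eta = Num.sqrt 2 / 8 * (3 + aplus / b) - 1 / 2 -> 0 <= x <= aplus ->
  8 * L * expR ((eta + 1) * L) <= 2 ^+ J ->
  L / b / 2 * expR (- (L / 2)) *
    (32 / 3 * expR (Num.sqrt 2 / 4 * (3 * (L / 2) + x * (L / b / 2))) / 2 ^+ J)
  <= eps / 3.
Proof.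
move=> b0 eps0 L0 eL etaE /andP[x0 xa] h.
have s0 : 0 <= Num.sqrt 2 :> R by rewrite sqrtr_ge0.
set M := expR (Num.sqrt 2 / 4 * _).
(* The source of [eta]: the exponents add up to [(sqrt 2 / 8 * (3 + x / b) - 1 / 2) * L], and
   [x <= aplus]. *)
have h1 : expR (- (L / 2)) * M <= expR (eta * L).
  rewrite -expRD ler_expR etaE.
  have : Num.sqrt 2 * (x * (L / b)) <= Num.sqrt 2 * (aplus * (L / b)).
    by rewrite ler_wpM2l // ler_wpM2r // divr_ge0 ?ltW.
  have -> : (Num.sqrt 2 / 8 * (3 + aplus / b) - 1 / 2) * L =
     Num.sqrt 2 / 8 * 3 * L + Num.sqrt 2 * (aplus * (L / b)) / 8 - L / 2 by field; rewrite gt_eqF.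
  lra.
have p2 : 0 < 2 ^+ J :> R by rewrite exprn_gt0.
have -> : L / b / 2 * expR (- (L / 2)) * (32 / 3 * M / 2 ^+ J) =
  (16 / 3 * (L / b)) * (expR (- (L / 2)) * M) / 2 ^+ J by field; rewrite !gt_eqF.
rewrite ler_pdivrMr //.
(* The extra [L] in the exponent supplies [e^L = 2 / (eps b)], which turns [eps / 3 * 8 L] into
   [16 / 3 * (L / b)]. *)
apply: (@le_trans _ _ (eps / 3 * (8 * L * expR ((eta + 1) * L)))); last first.
  by rewrite ler_wpM2l // divr_ge0 ?ltW.
have -> : (eta + 1) * L = eta * L + L by ring.
rewrite expRD eL.
have -> : eps / 3 * (8 * L * (expR (eta * L) * (2 / (eps * b)))) = 16 / 3 * (L / b) * expR (eta * L).
  by field; rewrite !gt_eqF.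
by rewrite ler_wpM2l // mulr_ge0 ?divr_ge0 ?ltW.
Qed.

(** The case [J = 0]: the condition forces [L <= 1 / 8], so [eps b = 2 e^(- L) >= 2 (1 - L) > 1]. *)
Lemma large_tolerance (b eps L eta : R) : 0 < b -> 0 < L ->
  expR L = 2 / (eps * b) -> 0 < eps -> 0 <= eta + 1 -> 8 * L * expR ((eta + 1) * L) <= 1 ->
  b^-1 < eps.
Proof.
move=> b0 L0 eL eps0 eta0 h.
have h1 : 1 <= expR ((eta + 1) * L).
  by rewrite -[leLHS]expR0 ler_expR mulr_ge0 // ltW.
have h2 : 8 * L <= 1 by apply: le_trans h; rewrite ler_peMr // mulr_ge0 // ltW.
have h3 : expR (- L) = eps * b / 2 by rewrite expRN eL invf_div.
have := expR_ge1Dx (- L); rewrite h3 => h4.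
rewrite -[b^-1]mul1r ltr_pdivrMr //; lra.
Qed.
End Constants.

(** The stated count is a real number, so [J] ranges over the naturals above it. [eps * b < 2] makes
    [T] positive. The largest time is bounded by [T], since Legendre roots are interior to
    [[-1, 1]]. *)
Theorem theorem1 (R : realType) (N : nat) (H : 'M[R[i]]_N) (E : 'I_N -> R)
    (a b eps : R) :
  (0 < N)%N ->
  is_hermitian_mx H ->
  (forall n m : 'I_N, (n <= m)%N -> E n <= E m) ->
  char_poly H = \prod_(n < N) ('X - (toC (E n))%:P) ->
  0 < b -> 0 < eps -> eps * b < 2 ->
  let z : R[i] := Complex a b in
  let aplus : R := \big[Num.max/0]_(n < N) `|a - E n| in
  let eta : R := (3 * b - 2 * Num.sqrt 2 * b + aplus) / (4 * Num.sqrt 2 * b) in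
  let T : R := ln (2 / (eps * b)) / b in
  forall J : nat,
    log2 (ln (2 / (eps * b))) + (eta + 1) * log2 (2 / (eps * b)) + 3 <= J%:R ->
    exists s w : 'I_J -> R,
      gauss_legendre s w /\
      opnorm2 (resolvent H z - gl_lcu H z T s w) < eps /\
      injective (gl_times T s) /\
      tnorm_inf (gl_times T s) <= T /\
      tnorm_1 (gl_times T s) = J%:R / (2 * b) * ln (2 / (eps * b)).
Proof.
move=> N0 Hherm _ Hchar b0 eps0 epsb z aplus eta T J hJ.
have x1 : 1 < 2 / (eps * b) by rewrite ltr_pdivlMr ?mulr_gt0 // mul1r.
have L0 : 0 < ln (2 / (eps * b)) by rewrite ln_gt0.
have eL : expR (ln (2 / (eps * b))) = 2 / (eps * b).
  by rewrite lnK // posrE (lt_trans ltr01).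
rewrite -{2}eL in hJ.
have h8 := node_count_bound L0 hJ.
move: (ln (2 / (eps * b))) L0 eL h8 @T {hJ} => L L0 eL h8 T.
have T0 : 0 < T by rewrite divr_gt0.
have bT : b * T = L by rewrite mulrC divfK // gt_eqF.
have aplusE n : 0 <= `|a - E n| <= aplus.
  by rewrite normr_ge0 /=; exact: (le_bigmax _ (fun n => `|a - E n|)).
have eta1 : 0 <= eta + 1.
  rewrite /eta etaE //.
  have : 0 <= Num.sqrt 2 / 8 * (3 + aplus / b).
    rewrite mulr_ge0 ?divr_ge0 ?sqrtr_ge0 // addr_ge0 // divr_ge0 ?(ltW b0) //.
    by have /andP[h1 h2] := aplusE (Ordinal N0); apply: le_trans h1 h2.
  lra.
have [s [w [GL sum0 w0 exact odd]]] := gauss_legendre_exists R J.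
have nodes j : -1 <= s j <= 1 by have [_ [h _]] := GL; exact: h.
exists s, w; split; first exact: GL.
split; last split; last split.
- have [P [e [Pu Pinv HE]]] := hermitian_conjdiag Hherm Hchar.
  have ze i : z - toC (E (e i)) != 0.
    by rewrite eq_complex /= negb_and subr0 (gt_eqF b0) orbT.
  pose f i := (z - toC (E (e i)))^-1 - (- iC R * toC (T / 2)) *
     \sum_(j < J) (toC (w j) * cexp ((iC R * z) * toC (gl_times T s j)))
        * cexp ((- iC R * toC (gl_times T s j)) * toC (E (e i))).
  have -> : resolvent H z - gl_lcu H z T s w = conjdiag P f.
    have -> : resolvent H z = conjdiag P (fun i => (z - toC (E (e i)))^-1).
      by rewrite /resolvent HE -(conjdiag_const Pu) conjdiagB invmx_conjdiag.
    have -> : gl_lcu H z T s w = conjdiag P (fun i => (- iC R * toC (T / 2)) *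
     \sum_(j < J) (toC (w j) * cexp ((iC R * z) * toC (gl_times T s j)))
        * cexp ((- iC R * toC (gl_times T s j)) * toC (E (e i)))).
      rewrite -conjdiagZ -conjdiag_sum /gl_lcu; congr (_ *: _).
      by apply: eq_bigr => j _; rewrite -conjdiagZ -(mxexp_conjdiag Pu) -conjdiagZ -HE.
    by rewrite conjdiagB.
  (* With no nodes the construction is the zero matrix, and the resolvent itself, of norm at most
     [1 / b], is below the tolerance. *)
  have [J0|Jpos] := posnP J.
    rewrite J0 expr0 in h8.
    have epsb1 := large_tolerance b0 L0 eL eps0 eta1 h8.
    apply: le_lt_trans epsb1; apply: opnorm2_conjdiag => // i.
    rewrite /f big1 ?mulr0 ?subr0; last first.
      by move=> j _; have : (j < 0)%N := leq_trans (ltn_ord j) (eq_leq J0).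
    have nz : b <= Normc.normc (z - toC (E (e i))).
      by apply: le_trans (imC_le_normc _); rewrite /= subr0 ler_norm.
    by rewrite Normc.normcV lef_pV2 ?posrE // (lt_le_trans b0).
  (* Truncation takes [eps / 2] and quadrature [eps / 3]; their sum leaves the strict inequality. *)
  apply: (@le_lt_trans _ _ (eps / 2 + eps / 3)); last by lra.
  apply: opnorm2_conjdiag => // i.
  pose mu := iC R * (z - toC (E (e i))) * toC (T / 2).
  have muE : mu = Complex (- (L / 2)) ((a - E (e i)) * (T / 2)).
    apply/eqP; rewrite eq_complex /= -bT; apply/andP; split; apply/eqP; ring.
  have mu0 : mu != 0.
    by rewrite muE eq_complex /= negb_and oppr_eq0 gt_eqF // divr_gt0.
  have hM (u : R[i]) : `|u| = sqrtC 2 -> Normc.normc (cexp (mu * ((u + u^-1) / 2)))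
      <= expR (Num.sqrt 2 / 4 * (3 * (L / 2) + `|a - E (e i)| * (L / b / 2))).
    move=> un; rewrite muE (le_trans (exp_ellipse_bound _ _ un)) //.
      by rewrite divr_ge0 // ltW.
    by rewrite normrM (ger0_norm (_ : 0 <= T / 2)) // divr_ge0 // ltW.
  have hQ := gauss_exp_error Jpos nodes w0 exact odd mu0 hM.
  apply: le_trans (resolvent_scalar_error b0 T0 hQ) _.
  rewrite bT lerD //.
    by rewrite expRN eL invf_div le_eqVlt; apply/orP; left; apply/eqP; field; rewrite gt_eqF.
  apply: (quadrature_term_bound b0 eps0 L0 eL (etaE aplus b0) (aplusE _) h8).
- move=> i j ij; have [s_inj _] := GL; apply: s_inj.
  have : T * (s i - s j) = 0 by move: ij; rewrite /gl_times; lra.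
  by move=> /eqP; rewrite mulf_eq0 gt_eqF //= subr_eq0 => /eqP.
- apply: bigmax_le => [|j _]; first exact: ltW.
  have /andP[s1 s2] := nodes j.
  rewrite /gl_times ger0_norm; last by rewrite divr_ge0 // mulr_ge0 ?(ltW T0) //; lra.
  by rewrite -mulrA ler_piMr ?(ltW T0) //; lra.
- rewrite /tnorm_1.
  (* All times are nonnegative, so absolute values drop and [sum_nodes] leaves [J T / 2]. *)
  have -> : \sum_(j < J) `|gl_times T s j| = \sum_(j < J) (T / 2 + T / 2 * s j).
    apply: eq_bigr => j _; have /andP[s1 s2] := nodes j.
    rewrite /gl_times ger0_norm; last by rewrite divr_ge0 // mulr_ge0 ?(ltW T0) //; lra.
    by field.
  rewrite big_split /= -[X in _ + X]mulr_sumr sum0 mulr0 addr0 sumr_const card_ord -mulr_natl /T.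
  by field; rewrite gt_eqF.
Qed.
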